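(* Let $f(z,\bar z)$ and $g(z,\bar z)$ be complex polynomials in $z$ and $\bar z$ with no common zeros in $\mathbb{C}$, with $\deg f\ge \deg g$. Let $d=\deg f$ and let $T(z,\bar z)$ be the homogeneous polynomial of degree $d$ consisting of the terms of $f$ of degree $d$. Assume that $T(z,\bar z)$ has a (finite or infinite) limit as $|z|\to\infty$, and that $R=\frac{f}{g}$ defines a continuous map $R:\bar{\mathbb{C}}\to\bar{\mathbb{C}}$ (with $R(z)=\infty$ where $g(z)=0$ and $R(\infty)=\lim_{|z|\to\infty} f(z)/g(z)$). Then the degree of $R$ equals $N-d$, where $N$ is the number of roots, counted with multiplicity, of the polynomial $\tilde T(z)=z^d\,T(z,z^{-1})$ of modulus less than $1$. Equivalently, the degree of $R$ equals the winding number about $0$ of the curve $[0,2\pi]\to\mathbb{C}\setminus\{0\}$, $\alpha\mapsto T(e^{i\alpha},e^{-i\alpha})$.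
   Context: $\bar{\mathbb{C}}=\mathbb{C}\cup\{\infty\}$ is the Riemann sphere, identified with $S^2$. The degree of a polynomial in $z,\bar z$ is its total degree (a monomial $z^a\bar z^b$ has degree $a+b$). $T(z,z^{-1})$ means substituting $z^{-1}$ for $\bar z$ in $T$; since $T$ is homogeneous of degree $d$, $\tilde T(z)=z^dT(z,z^{-1})$ is an ordinary polynomial in $z$. The degree of a continuous map $S^2\to S^2$ is the integer corresponding to its homotopy class under $\pi_2(S^2)\cong\mathbb{Z}$ with the identity having degree $1$. The winding number of a closed curve in $\mathbb{C}\setminus\{0\}$ is its class in $\pi_1(\mathbb{C}\setminus\{0\})\cong\mathbb{Z}$, with counterclockwise loops positive. *)

(* Defs.v *)
(* MathComp-Analysis (real type R, sin/cos/pi, topology of R),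
   mathcomp-real-closed (complex numbers R[i]) and multinomials (mpoly).
   Only the needed analysis files are imported (all_analysis clashes with
   mpoly's notations). *)
From HB Require Import structures.
From mathcomp Require Import all_boot all_order all_algebra.
From mathcomp Require Import mpoly.
From mathcomp Require Import complex.
From mathcomp Require Import boolp classical_sets set_interval reals.
From mathcomp Require Import topology normedtype trigo.

Set Implicit Arguments.
Unset Strict Implicit.
Unset Printing Implicit Defensive.

Import Order.TTheory GRing.Theory Num.Theory.
Import numFieldNormedType.Exports.
Local Open Scope ring_scope.
Local Open Scope classical_set_scope.
Local Open Scope ring_scope.
Local Open Scope complex_scope.

Section RiemannSphere.
Variable R : realType.
Local Notation C := R[i].

(** The Riemann sphere Cbar = C u {oo}: [Some z] is z, [None] is oo. *)
Definition sphere := option C.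

(** Euclidean modulus of a complex number, as a real number. *)
Definition cabs (z : C) : R :=
  let: a +i* b := z in Num.sqrt (a ^+ 2 + b ^+ 2).

(** The chordal metric on Cbar: it is the Euclidean distance in R^3 between
    the images on the unit sphere S^2 under inverse stereographic projection;
    so it induces on Cbar the topology of S^2. *)
Definition chord (x y : sphere) : R :=
  match x, y with
  | Some z, Some w => 2 * cabs (z - w) /
                        Num.sqrt ((1 + cabs z ^+ 2) * (1 + cabs w ^+ 2))
  | Some z, None | None, Some z => 2 / Num.sqrt (1 + cabs z ^+ 2)
  | None, None => 0
  end.

(** Continuity of a map Cbar -> Cbar. *)
Definition sphere_continuous (F : sphere -> sphere) : Prop :=
  forall x (e : R), 0 < e -> exists2 del : R, 0 < del &
    forall y, chord x y < del -> chord (F x) (F y) < e.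

(** Continuity of H : [0,1] x Cbar -> Cbar (product topology). *)
Definition homotopy_continuous (H : R -> sphere -> sphere) : Prop :=
  forall s x (e : R), 0 <= s <= 1 -> 0 < e -> exists2 del : R, 0 < del &
    forall t y, 0 <= t <= 1 -> `|s - t| < del -> chord x y < del ->
      chord (H s x) (H t y) < e.

(** Standard representative of degree n: z |-> z^n for n > 0,
    z |-> conj(z)^|n| for n < 0 (oo |-> oo in both cases), and the constant
    map 1 for n = 0.  For n = 1 it is the identity. *)
Definition std_map (n : int) (x : sphere) : sphere :=
  match x with
  | None => if n == 0 then Some 1 else None
  | Some z => Some (if 0 <= n then z ^+ `|n|%N else (z^*)%C ^+ `|n|%N)
  end.

(** [F] has degree [n]: [F] is (freely) homotopic to the standard map of
    degree [n].  By Hopf's theorem, homotopy classes of maps S^2 -> S^2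
    correspond bijectively to pi_2(S^2) = Z via the degree, and std_map n has
    degree n, so this is exactly "the homotopy class of F corresponds to n
    under pi_2(S^2) = Z, the identity having degree 1". *)
Definition has_degree (F : sphere -> sphere) (n : int) : Prop :=
  exists H : R -> sphere -> sphere,
    [/\ homotopy_continuous H, forall x, H 0 x = F x &
        forall x, H 1 x = std_map n x].

(** Winding number about 0 of a closed curve gamma : [a,b] -> C \ {0}:
    gamma does not vanish on [a,b] and admits a continuous argument theta with
    gamma = |gamma| e^{i theta}, and theta b - theta a = 2 pi n. *)
Definition expi (t : R) : C := (cos t) +i* (sin t).

Definition winding_number (gamma : R -> C) (a b : R) (n : int) : Prop :=
  exists theta : R -> R,
    [/\ forall t, a <= t <= b -> gamma t != 0,
        {within `[a, b], continuous theta},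
        forall t, a <= t <= b -> gamma t = (cabs (gamma t))%:C * expi (theta t) &
        theta b - theta a = 2 * pi * n%:~R].

(** Polynomials in z and zbar: variable 0 is z, variable 1 is zbar. *)
Definition zpoly := {mpoly C[2]}.

(** Evaluation p(z, zbar). *)
Definition ev (p : zpoly) (z : C) : C :=
  meval (fun i : 'I_2 => if val i == 0%N then z else (z^*)%C) p.

(** Evaluation p(u, v) at independent values. *)
Definition ev2 (p : zpoly) (u v : C) : C :=
  meval (fun i : 'I_2 => if val i == 0%N then u else v) p.

(** Total degree (msize p = 1 + total degree, msize 0 = 0). *)
Definition tdeg (p : zpoly) : nat := (msize p).-1.

(** Homogeneous part of degree d of p. *)
Definition homog_part (d : nat) (p : zpoly) : zpoly :=
  \sum_(m <- msupp p | mdeg m == d)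
     mcoeff m p *: mpolyX C m.

(** For T homogeneous of degree d, Ttilde(z) = z^d T(z, z^{-1}):
    the monomial c z^a zbar^b becomes c z^(d + a - b). *)
Definition tilde (d : nat) (T : zpoly) : {poly C} :=
  \sum_(m <- msupp T)
     mcoeff m T *: 'X^(d + m ord0 - m (lift ord0 ord0)).

(** [N] is the number of roots of [p], counted with multiplicity, of modulus
    less than 1. *)
Definition nroots_in_disk (p : {poly C}) (N : nat) : Prop :=
  exists2 rs : seq C, p = lead_coef p *: \prod_(r <- rs) ('X - r%:P) &
    N = count (fun r : C => `|r| < 1) rs.

(** The extension of R = f/g to Cbar. *)
Definition ratmap (f g : zpoly) (Rinf : sphere) (x : sphere) : sphere :=
  match x with
  | None => Rinf
  | Some z => if ev g z == 0 then None else Some (ev f z / ev g z)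
  end.

(** T(z, zbar) has a (finite or infinite) limit L as |z| -> oo. *)
Definition has_limit_at_infty (p : zpoly) : Prop :=
  exists L : sphere, forall e : R, 0 < e -> exists M : R,
    forall z : C, M < cabs z -> chord (Some (ev p z)) L < e.

End RiemannSphere.

(* Main.v *)
Require Import Defs.
From HB Require Import structures.
From mathcomp Require Import all_boot all_order all_algebra.
From mathcomp Require Import mpoly.
From mathcomp Require Import complex.
From mathcomp Require Import boolp classical_sets set_interval reals.
From mathcomp Require Import topology normedtype derive trigo.
From mathcomp Require Import ring lra zify.
Import Order.TTheory GRing.Theory Num.Theory.
Import numFieldNormedType.Exports.
Local Open Scope ring_scope.
Local Open Scope classical_set_scope.
Local Open Scope ring_scope.
Local Open Scope complex_scope.

Set Implicit Arguments.
Unset Strict Implicit.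
Unset Printing Implicit Defensive.

(** Write [f/g] as the map [z |-> [f z : g z]] to the projective line.  A homotopy of pairs
    [(f_s, g_s)] without common zeros, with [g_s / f_s] converging at infinity, is a homotopy
    of maps of the sphere.  Since [deg T >= 1] and [T] has a limit, [T] does not vanish on the
    unit circle, so [f] grows like [|z|^d] and its zeros lie in a disk.  The pair [(f, g)] maps
    a surface to [C^2 \ {0}], of real dimension 4, so some direction [(eps, c)], with [eps] as
    small as desired, is avoided by all positive multiples; moving [(f, g)] linearly against
    that direction deforms [f/g] to a polynomial map [k (f - a)], hence to [k T].  On the unit
    circle [T] is [conj(u)^d * Ttilde(u)]; contracting the roots of [Ttilde] inside the disk to
    0 and pushing the others to infinity leaves [conj(z)^d * (z/|z|)^N], which is homotopic to
    the standard map of degree [N - d].  The same factorization gives the winding number. *)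

(** Shrinking [g] alone cannot turn [f : g] into a polynomial map: every zero of [f] would end as a
    common zero. Shrinking [g] while a constant is present works if that constant exceeds [g] on the
    disk holding the zeros of [f]; but bringing the constant in from 0 may itself create a common
    zero. Hence the preliminary translation of both coordinates by [s * Mc * (eps, c)], along a
    direction that the pair never takes in the disk; outside the disk, the smallness of [eps] keeps
    [f] away from its translation. The dimension count behind this direction is made quantitative by
    Lipschitz bounds and a pigeonhole argument, in place of Sard's theorem. At infinity, deg g <=
    deg f bounds g/f, so continuity of the given map forces a finite limit of g/f, and the point at
    infinity can be sent to [1 : q] with [q] following the homotopy. Degree 0 is treated apart: [f]
    is then a nonzero constant, and [f : (1-s) g + s f] leads to the constant map 1. *)

Local Arguments cabs : simpl never.

(** * Modulus and limits *)

Section Modulus.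
Variable R : realType.
Implicit Types z w : R[i].

Lemma cabsE z : `|z| = (cabs z)%:C.
Proof. by rewrite normc_def; case: z. Qed.

Lemma cabs_ge0 z : 0 <= cabs z.
Proof. by case: z => a b; apply: sqrtr_ge0. Qed.

Lemma cabsM z w : cabs (z * w) = cabs z * cabs w.
Proof. by apply: complexI; rewrite rmorphM /= -!cabsE normrM. Qed.

Lemma cabs_eq0 z : (cabs z == 0) = (z == 0).
Proof.
rewrite -[RHS]normr_eq0 cabsE; apply/eqP/eqP => [->//|].
by move/complexI.
Qed.

Lemma cabs_gt0 z : (0 < cabs z) = (z != 0).
Proof. by rewrite lt_def cabs_ge0 andbT cabs_eq0. Qed.

Lemma cabs_real (x : R) : cabs x%:C = `|x|.
Proof. by rewrite /cabs /= expr0n addr0 sqrtr_sqr. Qed.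

Lemma cabs0 : cabs (0 : R[i]) = 0.
Proof. by apply/eqP; rewrite cabs_eq0. Qed.

Lemma cabs1 : cabs (1 : R[i]) = 1.
Proof. by apply: complexI; rewrite -cabsE normr1. Qed.

Lemma cabsN z : cabs (- z) = cabs z.
Proof. by apply: complexI; rewrite -!cabsE normrN. Qed.

Lemma cabsB z w : cabs (z - w) = cabs (w - z).
Proof. by rewrite -cabsN opprB. Qed.

Lemma ler_cabsD z w : cabs (z + w) <= cabs z + cabs w.
Proof. by rewrite -lecR rmorphD /= -!cabsE ler_normD. Qed.

Lemma ler_cabsB z w : cabs (z - w) <= cabs z + cabs w.
Proof. by rewrite -[cabs w]cabsN ler_cabsD. Qed.

Lemma lerB_cabsD z w : cabs z - cabs w <= cabs (z + w).
Proof. by rewrite lerBlDr -{1}(addrK w z) ler_cabsB. Qed.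

Lemma cabsV z : cabs z^-1 = (cabs z)^-1.
Proof. by apply: complexI; rewrite fmorphV /= -!cabsE normfV. Qed.

Lemma cabsX z n : cabs (z ^+ n) = cabs z ^+ n.
Proof. by apply: complexI; rewrite rmorphXn /= -!cabsE normrX. Qed.

Lemma cabsJ z : cabs (z^*) = cabs z.
Proof. by case: z => a b; rewrite /cabs /= sqrrN. Qed.

Lemma cabs_prod (I : Type) (s : seq I) (F : I -> R[i]) :
  cabs (\prod_(i <- s) F i) = \prod_(i <- s) cabs (F i).
Proof. exact: (big_morph (@cabs R) cabsM cabs1). Qed.

Lemma ler_cabs_sum (I : Type) (s : seq I) (F : I -> R[i]) :
  cabs (\sum_(i <- s) F i) <= \sum_(i <- s) cabs (F i).
Proof.
elim/big_ind2: _ => [|x u y v xu yv|//]; first by rewrite cabs0.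
by rewrite (le_trans (ler_cabsD _ _))// lerD.
Qed.

Lemma ler_Re_cabs z : `|complex.Re z| <= cabs z.
Proof. by rewrite -lecR -cabsE normc_ge_Re. Qed.

Lemma ler_Im_cabs z : `|complex.Im z| <= cabs z.
Proof.
case: z => a b; rewrite /cabs /= -sqrtr_sqr; apply: ler_wsqrtr.
by rewrite lerDr sqr_ge0.
Qed.

Lemma ler_cabs_ReIm z : cabs z <= `|complex.Re z| + `|complex.Im z|.
Proof.
case: z => a b; rewrite /cabs /=.
rewrite -[leRHS]ger0_norm ?addr_ge0// -sqrtr_sqr; apply: ler_wsqrtr.
rewrite sqrrD !real_normK ?num_real// -addrA (addrC (_ *+ 2)) addrA lerDl.
by rewrite mulrn_wge0// mulr_ge0.
Qed.

End Modulus.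

Section Limits.
Variable R : realType.
Local Notation C := R[i].

(** Spelled with the real-valued [cabs] and along an arbitrary filter, because the filters used
    below are neighbourhoods in the strip [0,1] x C, either of a point or of the end at infinity. *)
Definition clim T (F : set_system T) (A : T -> C) (a : C) : Prop :=
  forall e : R, 0 < e -> F [set x | cabs (A x - a) < e].

Section AlongFilter.
Context {T : Type} {F : set_system T} {FF : Filter F}.
Implicit Types A B : T -> C.

Lemma clim_ext A B a : A =1 B -> clim F A a -> clim F B a.
Proof. by move=> /funext ->. Qed.

Lemma clim_near A B a : F [set x | A x = B x] -> clim F A a -> clim F B a.
Proof.
move=> AB Aa e e0; have := Aa e e0; apply: filter_app.
by move: AB; apply: filterS => x /= ->.
Qed.

Lemma clim_cst a : clim F (fun=> a) a.
Proof. by move=> e e0; apply: nearW => x /=; rewrite subrr cabs0. Qed.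

Lemma climD A B a b : clim F A a -> clim F B b ->
  clim F (fun x => A x + B x) (a + b).
Proof.
move=> Aa Bb e e0; have e2 : 0 < e / 2 by lra.
have := Bb _ e2; apply: filter_app; have := Aa _ e2; apply: filterS => x /= h1 h2.
rewrite opprD addrACA (le_lt_trans (ler_cabsD _ _))//; lra.
Qed.

Lemma climN A a : clim F A a -> clim F (fun x => - A x) (- a).
Proof.
move=> Aa e e0; have := Aa _ e0; apply: filterS => x /=.
by rewrite -opprD cabsN.
Qed.

Lemma climB A B a b : clim F A a -> clim F B b ->
  clim F (fun x => A x - B x) (a - b).
Proof. by move=> Aa Bb; apply: climD => //; apply: climN. Qed.

Lemma climMbounded A B (K : R) : clim F A 0 -> F [set x | cabs (B x) <= K] ->
  clim F (fun x => A x * B x) 0.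
Proof.
move=> Aa Bb e e0.
have K0 : 0 < `|K| + 1 by have := normr_ge0 K; lra.
have eK : 0 < e / (`|K| + 1) by rewrite divr_gt0.
have := Aa _ eK; apply: filter_app; move: Bb; apply: filterS => x /= h1 h2.
rewrite !subr0 in h2 *; rewrite cabsM.
have h3 : cabs (B x) <= `|K| + 1 by have := ler_norm K; lra.
have := cabs_ge0 (A x); rewrite le_eqVlt => /predU1P[<-|A0].
  by rewrite mul0r.
rewrite (le_lt_trans (ler_wpM2l (ltW A0) h3))//.
by rewrite -ltr_pdivlMr.
Qed.

Lemma clim_bounded A a : clim F A a -> F [set x | cabs (A x) <= cabs a + 1].
Proof.
move=> /(_ 1 ltr01); apply: filterS => x /= h.
rewrite -(subrK a (A x)) (le_trans (ler_cabsD _ _))//; lra.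
Qed.

Lemma climM A B a b : clim F A a -> clim F B b ->
  clim F (fun x => A x * B x) (a * b).
Proof.
move=> Aa Bb.
have -> : a * b = 0 + 0 + a * b by rewrite !add0r.
have h1 : clim F (fun x => (A x - a) * B x) 0.
  apply: climMbounded (clim_bounded Bb).
  by rewrite -(subrr a); apply: climB => //; apply: clim_cst.
have h2 : clim F (fun x => (B x - b) * a) 0.
  apply: (@climMbounded _ _ (cabs a)); last by apply: nearW => x /=.
  by rewrite -(subrr b); apply: climB => //; apply: clim_cst.
apply: clim_ext (climD (climD h1 h2) (clim_cst (a * b))) => x; ring.
Qed.

Lemma climX A a n : clim F A a -> clim F (fun x => A x ^+ n) (a ^+ n).
Proof.
move=> Aa; elim: n => [|n IH]; first exact: clim_cst.
by rewrite exprS; apply: clim_ext (climM Aa IH) => x; rewrite exprS.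
Qed.

Lemma clim_sum (I : Type) (s : seq I) (A : I -> T -> C) (a : I -> C) :
  (forall i, clim F (A i) (a i)) ->
  clim F (fun x => \sum_(i <- s) A i x) (\sum_(i <- s) a i).
Proof.
move=> Aa; elim: s => [|i s IH].
  by rewrite big_nil; apply: clim_ext (clim_cst 0) => x; rewrite big_nil.
by rewrite big_cons; apply: clim_ext (climD (Aa i) IH) => x; rewrite big_cons.
Qed.

Lemma clim_prod (I : Type) (s : seq I) (A : I -> T -> C) (a : I -> C) :
  (forall i, clim F (A i) (a i)) ->
  clim F (fun x => \prod_(i <- s) A i x) (\prod_(i <- s) a i).
Proof.
move=> Aa; elim: s => [|i s IH].
  by rewrite big_nil; apply: clim_ext (clim_cst 1) => x; rewrite big_nil.
by rewrite big_cons; apply: clim_ext (climM (Aa i) IH) => x; rewrite big_cons.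
Qed.

Lemma clim_conj A a : clim F A a -> clim F (fun x => (A x)^*) (a^*).
Proof.
move=> Aa e e0; have := Aa _ e0; apply: filterS => x /=.
by rewrite -rmorphB cabsJ.
Qed.

Lemma clim_cabs A a : clim F A a -> clim F (fun x => (cabs (A x))%:C) ((cabs a)%:C).
Proof.
move=> Aa e e0; have := Aa _ e0; apply: filterS => x /=.
have -> : (cabs (A x))%:C - (cabs a)%:C = (cabs (A x) - cabs a)%:C.
  by rewrite rmorphB.
rewrite cabs_real; apply: le_lt_trans.
have h1 := lerB_cabsD (A x) (a - A x); have h2 := lerB_cabsD a (A x - a).
rewrite !subrKC (cabsB a) in h1 h2; rewrite ler_norml; lra.
Qed.

Lemma clim_cabs_gt A a k : clim F A a -> k < cabs a ->
  F [set x | k < cabs (A x)].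
Proof.
move=> Aa ka; have e0 : 0 < cabs a - k by lra.
have := Aa _ e0; apply: filterS => x /=; rewrite cabsB => h.
have := lerB_cabsD a (A x - a); rewrite subrKC cabsB in h * => h1.
by have := cabsB a (A x); lra.
Qed.

(** 1/A = (a - A) / (A a) + 1/a, and the first term is a null function times one that is bounded
    where |A| > |a|/2. *)
Lemma climV A a : a != 0 -> clim F A a -> clim F (fun x => (A x)^-1) a^-1.
Proof.
move=> a0 Aa; have a1 : 0 < cabs a by rewrite cabs_gt0.
have near1 : F [set x | cabs a / 2 < cabs (A x)].
  by apply: clim_cabs_gt Aa _; lra.
have h1 : clim F (fun x => (a - A x) * ((A x)^-1 * a^-1)) 0.
  apply: (@climMbounded _ _ ((cabs a / 2)^-1 * (cabs a)^-1)).
    by rewrite -(subrr a); apply: climB => //; apply: clim_cst.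
  apply: filterS near1 => x /= h.
  rewrite cabsM !cabsV ler_wpM2r// ?invr_ge0 ?cabs_ge0// lef_pV2 ?posrE//; lra.
rewrite -(add0r a^-1); apply: clim_near (climD h1 (clim_cst a^-1)).
apply: filterS near1 => x /= h.
have Ax0 : A x != 0 by rewrite -cabs_gt0; lra.
by field; rewrite a0 Ax0.
Qed.

End AlongFilter.
End Limits.

(** * Homotopies of the Riemann sphere *)

Section Sphere.
Variable R : realType.
Local Notation C := R[i].

(** The point [p : q] of the projective line in the chart p/q. The pair (0, 0), which names no
    point, also gets [None]. *)
Definition proj (p q : C) : sphere R := if q == 0 then None else Some (p / q).

Definition sqn (p q : C) : R := cabs p ^+ 2 + cabs q ^+ 2.

Implicit Types p q : C.

Lemma sqn_gt0 p q : p != 0 \/ q != 0 -> 0 < sqn p q.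
Proof.
rewrite /sqn => -[] h.
  by rewrite ltr_pwDl ?exprn_gt0 ?cabs_gt0// exprn_ge0 ?cabs_ge0.
by rewrite ltr_wpDl ?exprn_gt0 ?cabs_gt0// exprn_ge0 ?cabs_ge0.
Qed.

(** In homogeneous coordinates the chordal distance is twice the modulus of the determinant over the
    product of the norms, with no special role for infinity. The four cases are the vanishing of [q]
    and of [q']. *)
Lemma chord_proj p q (p' q' : C) : p != 0 \/ q != 0 -> p' != 0 \/ q' != 0 ->
  chord (proj p q) (proj p' q') =
  2 * cabs (p * q' - p' * q) / Num.sqrt (sqn p q * sqn p' q').
Proof.
have cabs_pos (a : C) : a != 0 -> 0 < cabs a by rewrite cabs_gt0.
have sqrt_sqn (a b : C) : b != 0 ->
    Num.sqrt (1 + cabs (a / b) ^+ 2) = Num.sqrt (sqn a b) / cabs b.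
  move=> /cabs_pos b0; rewrite cabsM cabsV.
  have -> : 1 + (cabs a / cabs b) ^+ 2 = sqn a b * (cabs b)^-1 ^+ 2.
    by rewrite /sqn; field; rewrite gt_eqF.
  by rewrite sqrtrM ?addr_ge0 ?exprn_ge0 ?cabs_ge0// sqrtr_sqr ger0_norm//
    invr_ge0 ltW.
move=> /sqn_gt0 h /sqn_gt0 h'.
rewrite (sqrtrM _ (ltW h)).
have s0 : 0 < Num.sqrt (sqn p q) by rewrite sqrtr_gt0.
have s1 : 0 < Num.sqrt (sqn p' q') by rewrite sqrtr_gt0.
have ge1 (a : C) : 0 <= 1 + cabs a ^+ 2 by rewrite addr_ge0// exprn_ge0 ?cabs_ge0.
move: s0 s1; rewrite /proj; case: eqP => [->|/eqP q0]; case: eqP => [->|/eqP q'0] s0 s1 /=.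
- by rewrite !mulr0 subrr cabs0 mulr0 mul0r.
- rewrite sqrt_sqn// mulr0 subr0 cabsM; move: s0.
  rewrite {1 3}/sqn cabs0 expr0n addr0 sqrtr_sqr ger0_norm ?cabs_ge0// => s0.
  by field; rewrite !gt_eqF ?cabs_pos// -cabs_gt0.
- rewrite sqrt_sqn// mulr0 sub0r cabsN cabsM; move: s1.
  rewrite {1 4}/sqn cabs0 expr0n addr0 sqrtr_sqr ger0_norm ?cabs_ge0// => s1.
  by field; rewrite !gt_eqF ?cabs_pos// -cabs_gt0.
- rewrite sqrtrM// !sqrt_sqn//.
  have -> : p / q - p' / q' = (p * q' - p' * q) / (q * q').
    by field; rewrite q0 q'0.
  rewrite cabsM cabsV cabsM.
  by field; rewrite !gt_eqF ?cabs_pos.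
Qed.

Lemma projZ (k p q : C) : k != 0 -> proj (k * p) (k * q) = proj p q.
Proof.
move=> k0; rewrite /proj mulf_eq0 (negbTE k0) /=; case: eqP => // /eqP q0.
by congr Some; field; rewrite q0 k0.
Qed.

(** The determinant p Q - P q tends to 0, while the norm of (P, Q) stays away from 0. *)
Lemma clim_proj T (F : set_system T) {FF : Filter F} (P Q : T -> C) p q :
  clim F P p -> clim F Q q -> p != 0 \/ q != 0 ->
  forall e : R, 0 < e -> F [set x | chord (proj p q) (proj (P x) (Q x)) < e].
Proof.
move=> Pp Qq pq e e0.
(* Whichever coordinate has a nonzero limit eventually exceeds half of that limit in modulus. *)
have [k k0 near_k] : exists2 k : R, 0 < k & F [set x | k <= sqn (P x) (Q x)].
  have key (A : T -> C) a : clim F A a -> a != 0 ->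
      F [set x | (cabs a / 2) ^+ 2 <= cabs (A x) ^+ 2].
    move=> Aa; rewrite -cabs_gt0 => a0.
    have h : cabs a / 2 < cabs a by lra.
    apply: filterS (clim_cabs_gt Aa h) => x /= h1.
    by rewrite lerXn2r ?nnegrE ?cabs_ge0// ltW// divr_gt0.
  case: pq => h; [exists ((cabs p / 2) ^+ 2) | exists ((cabs q / 2) ^+ 2)].
  - by rewrite exprn_gt0// divr_gt0 ?cabs_gt0.
  - by apply: filterS (key _ _ Pp h) => x /= /le_trans; apply;
      rewrite lerDl exprn_ge0 ?cabs_ge0.
  - by rewrite exprn_gt0// divr_gt0 ?cabs_gt0.
  - by apply: filterS (key _ _ Qq h) => x /= /le_trans; apply;
      rewrite lerDr exprn_ge0 ?cabs_ge0.
have n0 := sqn_gt0 pq.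
have D0 : 0 < Num.sqrt (sqn p q * k) by rewrite sqrtr_gt0 mulr_gt0.
have lim0 : clim F (fun x => p * Q x - P x * q) 0.
  have -> : 0 = p * q - p * q by rewrite subrr.
  by apply: climB; apply: climM => //; apply: clim_cst.
have e1 : 0 < e * Num.sqrt (sqn p q * k) / 2 by rewrite divr_gt0// mulr_gt0.
have := lim0 _ e1; apply: filter_app; apply: filterS near_k => x /= kx.
rewrite subr0 => small.
have PQ : P x != 0 \/ Q x != 0.
  apply/orP; rewrite -negb_and; apply/negP => /andP[/eqP Px /eqP Qx].
  move: kx; rewrite Px Qx /sqn cabs0 expr0n /= addr0; lra.
rewrite chord_proj// ltr_pdivrMr; last first.
  by rewrite sqrtr_gt0 mulr_gt0// sqn_gt0.
apply: (@lt_le_trans _ _ (e * Num.sqrt (sqn p q * k))); first lra.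
by rewrite ler_pM2l// ler_wsqrtr// ler_pM2l.
Qed.

Lemma chord_near (z : C) (del : R) : 0 < del -> exists2 del' : R, 0 < del' &
  forall y, chord (Some z) y < del' -> exists2 w, y = Some w & cabs (z - w) < del.
Proof.
move=> d0.
have sqrt_le (x : C) : Num.sqrt (1 + cabs x ^+ 2) <= 1 + cabs x.
  have x0 := cabs_ge0 x.
  rewrite -[leRHS]ger0_norm ?addr_ge0// -sqrtr_sqr ler_wsqrtr//.
  rewrite sqrrD expr1n mul1r; lra.
have sqrt_pos (x : C) : 0 < Num.sqrt (1 + cabs x ^+ 2).
  by rewrite sqrtr_gt0 ltr_pwDl// exprn_ge0 ?cabs_ge0.
set B := 1 + cabs z; have z0 := cabs_ge0 z.
have B0 : 0 < B by rewrite /B; lra.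
(* The first bound excludes the point at infinity, at chordal distance at least 2/B. With x = |z -
   w|, closeness yields 2 x < m B^2 + m B x; the two bounds turn this into 2 x < del + x. *)
exists (Num.min B^-1 (del / B ^+ 2)).
  by rewrite lt_min invr_gt0 B0 divr_gt0// exprn_gt0.
case=> [w|] /=; last first.
  rewrite lt_min => /andP[+ _]; rewrite ltr_pdivrMr// mulrC ltr_pdivlMr//.
  by have := sqrt_le z; rewrite -/B; lra.
set x := cabs (z - w) => h; exists w => //; rewrite -/x.
have x0 : 0 <= x := cabs_ge0 _.
set m := Num.min _ _ in h.
have m0 : 0 < m by rewrite lt_min invr_gt0 B0 divr_gt0// exprn_gt0.
have wle : cabs w <= cabs z + x.
  by rewrite /x cabsB -{1}(subrKC z w) ler_cabsD.
rewrite sqrtrM ?addr_ge0 ?exprn_ge0// ltr_pdivrMr ?mulr_gt0// in h.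
have h2 : 2 * x < m * (B * (B + x)).
  apply: lt_le_trans h _; rewrite ler_pM2l//.
  apply: ler_pM; [exact: ltW|exact: ltW|exact: sqrt_le|].
  by apply: le_trans (sqrt_le _) _; rewrite /B; lra.
have m1 : m * B <= 1 by rewrite -ler_pdivlMr// mul1r ge_min lexx.
have m2 : m * B ^+ 2 <= del by rewrite -ler_pdivlMr ?exprn_gt0// ge_min lexx orbT.
have m3 : m * B * x <= x by rewrite -[leRHS]mul1r ler_wpM2r.
have e1 : m * (B * (B + x)) = m * B ^+ 2 + m * B * x by ring.
lra.
Qed.

Lemma chord_near_infty (M : R) : exists2 del : R, 0 < del &
  forall y, chord (None : sphere R) y < del -> forall w, y = Some w -> M < cabs w.
Proof.
have M0 : 0 < 1 + `|M| by have := normr_ge0 M; lra.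
exists (2 / (1 + `|M|)); first by rewrite divr_gt0.
move=> y + w yw; rewrite {y}yw /=.
have w0 := cabs_ge0 w.
have p0 : 0 < Num.sqrt (1 + cabs w ^+ 2).
  by rewrite sqrtr_gt0 ltr_pwDl// exprn_ge0.
rewrite ltr_pdivrMr// mulrAC ltr_pdivlMr// ltr_pM2l// => h.
have : Num.sqrt (1 + cabs w ^+ 2) <= 1 + cabs w.
  rewrite -[leRHS]ger0_norm ?addr_ge0// -sqrtr_sqr ler_wsqrtr//.
  rewrite sqrrD expr1n mul1r; lra.
by have := ler_norm M; lra.
Qed.

(** Only times in [0,1] are constrained, as in [homotopy_continuous]: the families are controlled
    nowhere else. *)
Definition nbhs_strip (s : R) (z : C) : set_system (R * C) :=
  [set A | exists2 del : R, 0 < del & forall t w, 0 <= t <= 1 -> `|s - t| < del ->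
     cabs (z - w) < del -> A (t, w)].

(** The bound [M] is uniform for times near [s], as joint continuity at infinity demands. *)
Definition nbhs_strip_infty (s : R) : set_system (R * C) :=
  [set A | exists2 del : R, 0 < del & exists M : R, forall t w, 0 <= t <= 1 ->
     `|s - t| < del -> M < cabs w -> A (t, w)].

Global Instance nbhs_strip_filter s z : Filter (nbhs_strip s z).
Proof.
split.
- by exists 1.
- move=> A B [d1 d10 h1] [d2 d20 h2]; exists (Num.min d1 d2).
    by rewrite lt_min d10.
  by move=> t w t01; rewrite !lt_min => /andP[? ?] /andP[? ?]; split; [apply: h1|apply: h2].
- by move=> A B AB [d1 d10 h1]; exists d1 => // t w *; apply: AB; apply: h1.
Qed.

Global Instance nbhs_strip_infty_filter s : Filter (nbhs_strip_infty s).
Proof.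
split.
- by exists 1 => //; exists 0.
- move=> A B [d1 d10 [M1 h1]] [d2 d20 [M2 h2]]; exists (Num.min d1 d2).
    by rewrite lt_min d10.
  exists (Num.max M1 M2) => t w t01.
  by rewrite lt_min gt_max => /andP[? ?] /andP[? ?]; split; [apply: h1|apply: h2].
- move=> A B AB [d1 d10 [M h1]]; exists d1 => //; exists M => t w *.
  by apply: AB; apply: h1.
Qed.

Lemma clim_strip_time s z : clim (nbhs_strip s z) (fun x => x.1%:C) s%:C.
Proof.
move=> e e0; exists e => // t w _ /= + _.
have -> : t%:C - s%:C = (t - s)%:C by rewrite rmorphB.
by rewrite cabs_real distrC.
Qed.

Lemma clim_strip_infty_time s : clim (nbhs_strip_infty s) (fun x => x.1%:C) s%:C.
Proof.
move=> e e0; exists e => //; exists 0 => t w _ /= + _.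
have -> : t%:C - s%:C = (t - s)%:C by rewrite rmorphB.
by rewrite cabs_real distrC.
Qed.

Lemma clim_strip_point s z : clim (nbhs_strip s z) (fun x => x.2) z.
Proof. by move=> e e0; exists e => // t w _ /= _; rewrite cabsB. Qed.

(** [has_degree F n] unfolds to [homotopic F (std_map n)]. *)
Definition homotopic (F G : sphere R -> sphere R) : Prop :=
  exists H : R -> sphere R -> sphere R,
    [/\ homotopy_continuous H, forall x, H 0 x = F x & forall x, H 1 x = G x].

Lemma homotopic_trans F G K : homotopic F G -> homotopic G K -> homotopic F K.
Proof.
move=> [H1 [c1 H10 H11]] [H2 [c2 H20 H21]].
exists (fun s x => if s <= 1 / 2 then H1 (2 * s) x else H2 (2 * s - 1) x).
split=> [s x e s01 e0|x|x]; last 2 first.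
- by rewrite ifT ?mulr0//; lra.
- by rewrite ifF; [rewrite mulr1 (_ : 2 - 1 = 1) ?H21//; lra|apply/negbTE; rewrite -ltNge; lra].
have [sl|sg|seq] := ltrgtP s (1 / 2).
- have s01' : 0 <= 2 * s <= 1 by lra.
  have [d d0 h] := c1 (2 * s) x e s01' e0.
  exists (Num.min (d / 2) (1 / 2 - s)); first by rewrite lt_min; lra.
  move=> t y t01; rewrite !lt_min ltr_norml !ltr_norml => /andP[/andP[? ?] /andP[? ?]] /andP[? ?].
  have tl : t <= 1 / 2 by lra.
  by rewrite tl; apply: h; [lra|rewrite ltr_norml; lra|lra].
- have s01' : 0 <= 2 * s - 1 <= 1 by lra.
  have [d d0 h] := c2 (2 * s - 1) x e s01' e0.
  exists (Num.min (d / 2) (s - 1 / 2)); first by rewrite lt_min; lra.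
  move=> t y t01; rewrite !lt_min ltr_norml !ltr_norml => /andP[/andP[? ?] /andP[? ?]] /andP[? ?].
  have tl : 1 / 2 < t by lra.
  by rewrite leNgt tl /=; apply: h; [lra|rewrite ltr_norml; lra|lra].
(* At the seam both pieces take the value [G x], so the continuity of each one controls its own
   side. *)
- have s01' : 0 <= 2 * s <= 1 by lra.
  have s01'' : 0 <= 2 * s - 1 <= 1 by lra.
  have [d d0 h] := c1 (2 * s) x e s01' e0.
  have [d' d'0 h'] := c2 (2 * s - 1) x e s01'' e0.
  exists (Num.min (d / 2) (d' / 2)); first by rewrite lt_min; lra.
  move=> t y t01; rewrite !lt_min !ltr_norml => /andP[/andP[? ?] /andP[? ?]] /andP[? ?].
  case: (leP t (1 / 2)) => tl; first by apply: h; [lra|rewrite ltr_norml; lra|lra].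
  have -> : H1 (2 * s) x = H2 (2 * s - 1) x.
    by rewrite seq (_ : 2 * (1 / 2) = 1) ?subrr ?H11 ?H20//; lra.
  by apply: h'; [lra|rewrite ltr_norml; lra|lra].
Qed.

(** The value at infinity is [1 : q], where [q] stands for the limit of Q/P: it may be infinite (q =
    0) but is never 0. *)
Definition proj_ext (P Q : C -> C) (q : C) (x : sphere R) : sphere R :=
  if x is Some z then proj (P z) (Q z) else proj 1 q.

(** Near a finite point, [clim_proj] applies to (P, Q); near infinity, dividing by [P] gives (1,
    Q/P), and it applies with limit (1, q). The point at infinity at a nearby time is a separate
    case, which uses the continuity of [q]. *)
Lemma pair_homotopy (P Q : R -> C -> C) (q : R -> C) :
  (forall s z, 0 <= s <= 1 -> clim (nbhs_strip s z) (fun x => P x.1 x.2) (P s z)) ->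
  (forall s z, 0 <= s <= 1 -> clim (nbhs_strip s z) (fun x => Q x.1 x.2) (Q s z)) ->
  (forall s z, 0 <= s <= 1 -> P s z != 0 \/ Q s z != 0) ->
  (forall s, 0 <= s <= 1 -> nbhs_strip_infty s [set x | P x.1 x.2 != 0]) ->
  (forall s, 0 <= s <= 1 ->
     clim (nbhs_strip_infty s) (fun x => Q x.1 x.2 / P x.1 x.2) (q s)) ->
  (forall s, 0 <= s <= 1 -> clim (nbhs_strip_infty s) (fun x => q x.1) (q s)) ->
  homotopic (proj_ext (P 0) (Q 0) (q 0)) (proj_ext (P 1) (Q 1) (q 1)).
Proof.
move=> Pc Qc PQ0 Pinf PQinf qc.
exists (fun s => proj_ext (P s) (Q s) (q s)); split=> // s [z|] e s01 e0.
  have [d d0 h] := clim_proj (Pc s z s01) (Qc s z s01) (PQ0 s z s01) e0.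
  have [d' d'0 h'] := chord_near z d0.
  exists (Num.min d d'); first by rewrite lt_min d0.
  move=> t y t01; rewrite !lt_min => /andP[st _] /andP[_ /h'[w -> zw]] /=.
  exact: (h t w t01 st zw).
have one0 : (1 : C) != 0 \/ q s != 0 by left; apply: oner_neq0.
have [d d0 [M h]] := clim_proj (clim_cst 1) (PQinf s s01) one0 e0.
have [d1 d10 [M1 h1]] := clim_proj (clim_cst 1) (qc s s01) one0 e0.
have [d2 d20 [M2 h2]] := Pinf s s01.
have [d3 d30 h3] := chord_near_infty (Num.max M M2).
exists (Num.min (Num.min d d1) (Num.min d2 d3)).
  by rewrite !lt_min d0 d10 d20.
move=> t y t01; rewrite !lt_min.
move=> /andP[/andP[sd sd1] /andP[sd2 _]] /andP[_ /andP[_ /h3]].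
case: y => [w /(_ w erefl)|_] /=.
  rewrite gt_max => /andP[Mw M2w].
  have Pw : P t w != 0 := h2 t w t01 sd2 M2w.
  rewrite -(projZ (P t w) (Q t w) (invr_neq0 Pw)) mulVf// (mulrC _ (Q t w)).
  exact: (h t w t01 sd Mw).
(* The continuity of [q] is stated along the filter at infinity although [q] depends on time only;
   any far point gives access to it. *)
have [w M1w] : exists w : C, M1 < cabs w.
  exists (`|M1| + 1)%:C; rewrite cabs_real ger0_norm ?addr_ge0//.
  by have := ler_norm M1; lra.
exact: (h1 t w t01 sd1 M1w).
Qed.

End Sphere.

(** * Polynomials in z and its conjugate *)

Section Polynomials.
Variable R : realType.
Local Notation C := R[i].
Local Notation i1 := (lift ord0 ord0 : 'I_2).
Implicit Types (p : zpoly R) (z w u v : C) (m : 'X_{1.. 2}).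

Lemma ev2E p u v :
  ev2 p u v = \sum_(m <- msupp p) p@_m * (u ^+ m ord0 * v ^+ m i1).
Proof.
rewrite /ev2 mevalE; apply: eq_bigr => m _; congr (_ * _).
by rewrite big_ord_recl big_ord1.
Qed.

Lemma evE p z :
  ev p z = \sum_(m <- msupp p) p@_m * (z ^+ m ord0 * (z^*) ^+ m i1).
Proof. exact: ev2E. Qed.

Lemma mdeg2 m : mdeg m = (m ord0 + m i1)%N.
Proof. by rewrite mdegE big_ord_recl big_ord1. Qed.

Lemma evB p p' z : ev (p - p') z = ev p z - ev p' z.
Proof. exact: mevalB. Qed.

Lemma clim_ev T (F : set_system T) {FF : Filter F} p (A : T -> C) a :
  clim F A a -> clim F (fun x => ev p (A x)) (ev p a).
Proof.
move=> Aa; rewrite evE.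
apply: (clim_ext (fun x => esym (evE p (A x)))).
apply: clim_sum => m; apply: climM; first exact: clim_cst.
by apply: climM; apply: climX => //; apply: clim_conj.
Qed.

(** The constant is the sum of the moduli of the coefficients; r >= 1 bounds every lower power by
    [r ^+ k]. *)
Lemma ev_bound p k : (forall m, m \in msupp p -> (mdeg m <= k)%N) ->
  exists2 K : R, 0 <= K & forall (r : R) z, 1 <= r -> cabs z <= r ->
    cabs (ev p z) <= K * r ^+ k.
Proof.
move=> pk; exists (\sum_(m <- msupp p) cabs p@_m).
  by apply: sumr_ge0 => m _; apply: cabs_ge0.
move=> r z r1 zr; rewrite evE (le_trans (ler_cabs_sum _ _))//.
rewrite mulr_suml [leLHS]big_seq [leRHS]big_seq; apply: ler_sum => m mp.
rewrite cabsM ler_wpM2l ?cabs_ge0// cabsM !cabsX cabsJ -exprD -mdeg2.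
apply: (@le_trans _ _ (r ^+ mdeg m)).
  by rewrite lerXn2r ?nnegrE ?cabs_ge0//; lra.
by rewrite ler_weXn2l// pk.
Qed.

(** Functions that are both bounded and Lipschitz on the disk are closed under sums and products;
    boundedness is carried along for the sake of products. *)
Lemma ev_lipschitz p (r : R) : exists2 L : R, 0 <= L & forall z w,
  cabs z <= r -> cabs w <= r -> cabs (ev p z - ev p w) <= L * cabs (z - w).
Proof.
pose lip (A : C -> C) := exists K L : R, [/\ 0 <= K, 0 <= L,
  forall z, cabs z <= r -> cabs (A z) <= K & forall z w,
  cabs z <= r -> cabs w <= r -> cabs (A z - A w) <= L * cabs (z - w)].
have lip_cst a : lip (fun=> a).
  by exists (cabs a), 0; split=> // [|z w _ _]; rewrite ?cabs_ge0// subrr cabs0 mul0r.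
have lipD A B : lip A -> lip B -> lip (fun z => A z + B z).
  move=> [K [L [K0 L0 hK hL]]] [K' [L' [K'0 L'0 hK' hL']]].
  exists (K + K'), (L + L'); split; rewrite ?addr_ge0//.
    by move=> z zr; rewrite (le_trans (ler_cabsD _ _))// lerD ?hK ?hK'.
  move=> z w zr wr; rewrite opprD addrACA (le_trans (ler_cabsD _ _))//.
  by rewrite mulrDl lerD ?hL ?hL'.
have lipM A B : lip A -> lip B -> lip (fun z => A z * B z).
  move=> [K [L [K0 L0 hK hL]]] [K' [L' [K'0 L'0 hK' hL']]].
  exists (K * K'), (L * K' + K * L'); split; rewrite ?addr_ge0 ?mulr_ge0//.
    by move=> z zr; rewrite cabsM ler_pM ?cabs_ge0 ?hK ?hK'.
  move=> z w zr wr.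
  have -> : A z * B z - A w * B w = (A z - A w) * B z + A w * (B z - B w) by ring.
  rewrite (le_trans (ler_cabsD _ _))// [leRHS]mulrDl lerD// cabsM.
    by rewrite mulrAC ler_pM ?cabs_ge0 ?hL ?hK'.
  by rewrite -mulrA ler_pM ?cabs_ge0 ?hL' ?hK.
have lipX A n : lip A -> lip (fun z => A z ^+ n).
  move=> lA; elim: n => [|n IH]; first exact: lip_cst.
  by rewrite (funext (fun z => exprS (A z) n)); apply: lipM.
have lip_id : lip id.
  by exists (Num.max r 0), 1; split=> // [|z zr|z w _ _];
    rewrite ?mul1r// le_max ?lexx ?orbT ?zr.
have lip_conj : lip (fun z => z^*).
  exists (Num.max r 0), 1; split=> // [|z zr|z w _ _].
  - by rewrite le_max lexx orbT.
  - by rewrite cabsJ le_max zr.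
  - by rewrite mul1r -rmorphB cabsJ.
suff [K [L [_ L0 _ hL]]] : lip (ev p) by exists L.
have lip_ext A B : A =1 B -> lip A -> lip B by move=> /funext ->.
apply: (lip_ext) (fsym (evE p)) _; elim: (msupp p) => [|m s IH].
  by apply: (lip_ext) (lip_cst 0) => z; rewrite big_nil.
have lip_m : lip (fun z => p@_m * (z ^+ m ord0 * (z^*) ^+ m i1)).
  by apply: (lipM) => //; apply: (lipM); apply: lipX.
by apply: (lip_ext) (lipD _ _ lip_m IH) => z; rewrite big_cons.
Qed.

Lemma mcoeff_homog_part d p m :
  (homog_part d p)@_m = if mdeg m == d then p@_m else 0.
Proof.
rewrite /homog_part raddf_sum /=.
under eq_bigr do rewrite mcoeffZ mcoeffX.
have [md|md] := boolP (mdeg m == d); last first.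
  rewrite big1 // => m' /eqP m'd; case: eqP => [mm|]; last by rewrite mulr0.
  by rewrite -mm m'd eqxx in md.
have [mp|mp] := boolP (m \in msupp p); last first.
  rewrite (memN_msupp_eq0 mp) big_seq_cond big1 // => m' /andP[m'p _].
  case: eqP => [mm|]; last by rewrite mulr0.
  by rewrite -mm m'p in mp.
rewrite big_mkcond (bigD1_seq m) ?msupp_uniq//= md eqxx mulr1 big1 ?addr0//.
by move=> m' /negbTE m'm; rewrite m'm mulr0; case: ifP.
Qed.

Lemma msupp_homog_part d p m : m \in msupp (homog_part d p) -> mdeg m = d.
Proof.
by rewrite mcoeff_msupp mcoeff_homog_part; case: (mdeg m =P d); rewrite ?eqxx.
Qed.

Lemma homog_part_tdeg_neq0 p : p != 0 -> homog_part (tdeg p) p != 0.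
Proof.
move=> p0; have mp := mlead_supp p0; have md := mlead_deg p0; move: (mlead p) mp md => m mp md.
apply: contraTneq mp => T0; have := mcoeff_homog_part (tdeg p) p m.
by rewrite T0 mcoeff0 /tdeg -md eqxx => /esym/eqP; rewrite mcoeff_eq0.
Qed.

Lemma msupp_sub_homog_part p m :
  m \in msupp (p - homog_part (tdeg p) p) -> (mdeg m < tdeg p)%N.
Proof.
rewrite mcoeff_msupp mcoeffB mcoeff_homog_part.
case: (mdeg m =P _) => [_|/eqP md]; first by rewrite subrr eqxx.
rewrite subr0 -mcoeff_msupp => mp; rewrite ltn_neqAle md /=.
by have := msize_mdeg_lt mp; rewrite /tdeg; case: (msize p).
Qed.

(** For a + b = d the exponent d + a - b is 2 a, so the truncated subtraction is harmless, and v^d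
    u^(2a) = (u v)^a u^a v^b. *)
Lemma ev2_tilde d p u v : (forall m, m \in msupp p -> mdeg m = d) ->
  u * v = 1 -> ev2 p u v = v ^+ d * (tilde d p).[u].
Proof.
move=> pd uv; rewrite ev2E /tilde horner_sum mulr_sumr.
rewrite [LHS]big_seq [RHS]big_seq; apply: eq_bigr => m /pd.
rewrite mdeg2 => <-; rewrite hornerZ hornerXn [RHS]mulrCA; congr (_ * _).
rewrite (_ : (_ + m ord0 - _ = m ord0 + m ord0)%N); last by lia.
rewrite [RHS](_ : _ = (u * v) ^+ m ord0 * (u ^+ m ord0 * v ^+ m i1)).
  by rewrite uv expr1n mul1r.
by rewrite !exprD exprMn; ring.
Qed.

(** With u = z/|z| one has conj(z) u^2 = z, hence conj(z)^d u^(2a) = z^a conj(z)^b when a + b =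
    d. *)
Lemma ev_tilde d p z : (forall m, m \in msupp p -> mdeg m = d) -> z != 0 ->
  ev p z = (z^*) ^+ d * (tilde d p).[z / (cabs z)%:C].
Proof.
move=> pd z0; rewrite evE /tilde horner_sum mulr_sumr.
rewrite [LHS]big_seq [RHS]big_seq; apply: eq_bigr => m /pd.
rewrite mdeg2 => <-; rewrite hornerZ hornerXn [RHS]mulrCA; congr (_ * _).
rewrite (_ : (_ + m ord0 - _ = m ord0 + m ord0)%N); last by lia.
have c0 : (cabs z)%:C != 0 by rewrite -cabsE normr_eq0.
rewrite [RHS](_ : _ = (z^*) ^+ m i1 * (z^* * (z / (cabs z)%:C) * (z / (cabs z)%:C)) ^+ m ord0).
  rewrite mulrC; congr (_ * _ ^+ _).
  rewrite (_ : _ * _ * _ = z * (z * z^*) / (cabs z)%:C ^+ 2); last by field.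
  by rewrite -sqr_normc cabsE mulfK// expf_neq0.
by rewrite !exprMn !exprD; ring.
Qed.

(** Among monomials of degree [d], the exponent of z determines the monomial, so distinct ones go to
    distinct powers and nothing cancels. *)
Lemma tilde_neq0 d p : (forall m, m \in msupp p -> mdeg m = d) -> p != 0 ->
  tilde d p != 0.
Proof.
move=> pd p0; have [m mp] : exists m, m \in msupp p.
  move: p0; rewrite -msupp_eq0; case: (msupp p) => // m s _.
  by exists m; rewrite inE eqxx.
have two m' : m' \in msupp p -> (d + m' ord0 - m' i1 = (m' ord0).*2)%N.
  by move=> /pd; rewrite mdeg2; lia.
suff: (tilde d p)`_((m ord0).*2) != 0 by apply: contraNneq => ->; rewrite coef0.
rewrite /tilde coef_sum (bigD1_seq m) ?msupp_uniq//= two// coefZ coefXn eqxx mulr1.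
rewrite big_seq_cond big1 ?addr0 -?mcoeff_msupp// => m' /andP[m'p m'm].
rewrite two// coefZ coefXn; case: eqP => [e|]; last by rewrite mulr0.
case/eqP: m'm; apply/mnmP => i.
have e0 : m' ord0 = m ord0 by lia.
have e1 : m' i1 = m i1 by have := pd _ mp; have := pd _ m'p; rewrite !mdeg2; lia.
by case: (unliftP ord0 i) => [j ->|->//]; rewrite ord1.
Qed.

Lemma size_tilde0 p : (forall m, m \in msupp p -> mdeg m = 0%N) ->
  (size (tilde 0 p) <= 1)%N.
Proof.
move=> pd; rewrite /tilde big_seq; elim/big_ind: _ => [|q q' sq sq'|m /pd md].
- by rewrite size_poly0.
- by rewrite (leq_trans (size_polyD _ _))// geq_max sq.
- rewrite (leq_trans (size_scale_leq _ _))// size_polyXn.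
  by rewrite mdeg2 in md; lia.
Qed.

End Polynomials.

(** * A direction avoided by a pair without common zeros *)

Section GenericDirection.
Variable R : realType.
Local Notation C := R[i].

Definition lipschitz_square (K : R) (h : R -> R -> R) : Prop :=
  forall x y x' y', 0 <= x <= 1 -> 0 <= y <= 1 -> 0 <= x' <= 1 -> 0 <= y' <= 1 ->
    `|h x y - h x' y'| <= K * (`|x - x'| + `|y - y'|).

Lemma lipschitz_square_min (K : R) (h : R -> R -> R) : 0 < K ->
  lipschitz_square K h ->
  (forall x y, 0 <= x <= 1 -> 0 <= y <= 1 -> 0 < h x y) ->
  exists2 del : R, 0 < del &
    forall x y, 0 <= x <= 1 -> 0 <= y <= 1 -> del <= h x y.
Proof.
move=> K0 hK h0.
pose A : set (R * R) := `[0, 1] `*` `[0, 1].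
have inA (p : R * R) : A p <-> 0 <= p.1 <= 1 /\ 0 <= p.2 <= 1.
  by rewrite /A /setX /= !in_itv.
have A0 : A !=set0 by exists (0, 0); apply/inA => /=; lra.
have cA : compact A by apply: compact_setX; apply: segment_compact.
have ch : {within A, continuous (fun p : R * R => h p.1 p.2)}.
  apply/subspace_continuousP => -[x y] /inA/= [x01 y01].
  apply/cvgrPdist_lt => e e0; apply/nbhs_ballP.
  exists (e / (K * 2)) => /=; first by rewrite divr_gt0// mulr_gt0.
  move=> [x' y'] [/= dx dy] /inA /= [x'01 y'01].
  rewrite (le_lt_trans (hK _ _ _ _ _ _ _ _))//.
  rewrite -ltr_pdivlMl// mulrC.
  have : e / (K * 2) = e / K / 2 by field; rewrite gt_eqF.
  have {}dx : `|x - x'| < e / (K * 2) := dx.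
  have {}dy : `|y - y'| < e / (K * 2) := dy.
  lra.
have [[x y] /set_mem/inA/= [x01 y01] hmin] := compact_EVT_min A0 cA ch.
exists (h x y); first exact: h0.
by move=> x' y' x'01 y'01; apply: (hmin (x', y')); apply/mem_set/inA.
Qed.

(* Pigeonhole: if all n^3 points of a grid were ratios h_i / h0 attained at some point of
   the square, two of those points would share one of the O(n^2) cells of side O(1/n),
   contradicting the Lipschitz bound. *)
Lemma lipschitz_square_avoid (K del : R) (h0 : R -> R -> R) (h : 'I_3 -> R -> R -> R) :
  0 < K -> 0 < del -> lipschitz_square K h0 -> (forall i, lipschitz_square K (h i)) ->
  (forall x y, 0 <= x <= 1 -> 0 <= y <= 1 ->
     (forall i, `|h i x y| <= h0 x y) -> del <= h0 x y) ->
  exists2 a : 'I_3 -> R, (forall i, 0 <= a i <= 1) &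
    forall x y, 0 <= x <= 1 -> 0 <= y <= 1 -> 0 < h0 x y ->
      ~ (forall i, h i x y = h0 x y * a i).
Proof.
move=> K0 del0 h0K hK hdel; apply: contrapT => noa.
(* [M] is chosen for [M%:R * del > 4 * K], the inequality that the collision contradicts. *)
pose M := (Num.truncn (4 * K / del)).+1.
have M0 : 0 < M%:R :> R by rewrite ltr0n.
have MK : 4 * K < M%:R * del.
  rewrite -ltr_pdivrMr//.
  by have /andP[] := truncn_itv (ltW (divr_gt0 (mulr_gt0 (ltr0n R 4) K0) del0)).
(* Makes (M n + 1)^2 < n^3: fewer cells than grid points. *)
pose n := (M ^ 2 + 2 * M + 2)%N.
have n0 : 0 < n%:R :> R by rewrite ltr0n /n; lia.
pose N := (M * n)%N.
have N0 : 0 < N%:R :> R by rewrite /N natrM mulr_gt0.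
have hit (k : {ffun 'I_3 -> 'I_n}) : exists p : R * R,
    [/\ 0 <= p.1 <= 1, 0 <= p.2 <= 1, 0 < h0 p.1 p.2 &
        forall i, h i p.1 p.2 = h0 p.1 p.2 * ((k i)%:R / n%:R)].
  apply: contrapT => nok; apply: noa; exists (fun i => (k i)%:R / n%:R).
    move=> i; rewrite divr_ge0//= ler_pdivrMr// mul1r ler_nat; exact: ltnW.
  by move=> x y x01 y01 hp hi; apply: nok; exists (x, y).
have [pt ptP] := choice hit.
(* There are N + 1 intervals because x = 1 has index [N]. *)
pose cell (x : R) : 'I_N.+1 := inord (Num.truncn (x * N%:R)).
have cell_close x x' : 0 <= x <= 1 -> 0 <= x' <= 1 -> cell x = cell x' ->
    `|x - x'| <= N%:R^-1.
  have cellE y : 0 <= y <= 1 -> (cell y : nat)%:R <= y * N%:R < (cell y).+1%:R.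
    move=> /andP[y0 y1].
    have yN : 0 <= y * N%:R by rewrite mulr_ge0// ltW.
    rewrite /cell inordK; first exact: truncn_itv.
    by rewrite truncn_lt_nat// -natr1 (le_lt_trans (ler_wpM2r (ltW N0) y1))// mul1r; lra.
  move=> x01 x'01 e; have := cellE x x01; have := cellE x' x'01; rewrite e -natr1.
  move=> /andP[h1 h2] /andP[h3 h4].
  rewrite -(ler_pM2r N0) mulVf ?lt0r_neq0//.
  by rewrite -{1}(ger0_norm (ltW N0)) -normrM mulrBl ler_norml; lra.
pose cells k := (cell (pt k).1, cell (pt k).2).
have [inj|/injectivePn[k [l kl e]]] := boolP (injectiveb cells).
  move/injectiveP: inj => /leq_card.
  rewrite card_ffun card_prod !card_ord leqNgt => /negP; apply.
  rewrite /N; move: n0 => _; rewrite /n; clear; nia.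
have [i kli] : exists i, k i != l i.
  apply/existsP; apply: contraR kl => /existsPn kl.
  by apply/eqP/ffunP => i; apply/eqP/negPn/kl.
have [kx ky kh kE] := ptP k; have [lx ly lh lE] := ptP l.
case: e => /(cell_close _ _ kx lx) dx /(cell_close _ _ ky ly) dy.
have d0 := h0K _ _ _ _ kx ky lx ly; have di := hK i _ _ _ _ kx ky lx ly.
have frac (m : 'I_n) : 0 <= (m%:R / n%:R : R) <= 1.
  by rewrite divr_ge0//= ler_pdivrMr// mul1r ler_nat ltnW.
(* The ratios lie in [0,1], so every [h i] is bounded by [h0] there and the lower bound applies. *)
have hk : del <= h0 (pt k).1 (pt k).2.
  apply: hdel => // j; rewrite kE normrM gtr0_norm//.
  have /andP[f0 f1] := frac (k j).
  by rewrite ger0_norm// -[leRHS]mulr1 ler_pM2l.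
move: d0 di; rewrite kE lE.
set u := h0 _ _ in hk *; set v := h0 _ _.
set a := (k i)%:R / n%:R; set b := (l i)%:R / n%:R => d0 di.
have b01 : 0 <= b <= 1 := frac (l i).
have ab : n%:R^-1 <= `|a - b|.
  rewrite /a /b -mulrBl normrM [`|n%:R^-1|]gtr0_norm ?invr_gt0// -[leLHS]mul1r.
  rewrite ler_pM2r ?invr_gt0//.
  have : (k i < l i)%N \/ (l i < k i)%N.
    by move: kli; rewrite -val_eqE neq_ltn => /orP.
  rewrite -!(ler_nat R) -!natr1 ler_normr => -[] ?; apply/orP; [right|left]; lra.
have bound : K * (`|(pt k).1 - (pt l).1| + `|(pt k).2 - (pt l).2|) <= 2 * K / N%:R.
  by rewrite -mulrA mulrCA ler_pM2l//; lra.
have : u * `|a - b| <= 4 * K / N%:R.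
  rewrite -[u in leLHS]gtr0_norm// -normrM.
  (* Both differences are Lipschitz increments within one cell, at most 2 K / N each. Since |a - b|
     >= 1/n, this gives del / n <= 4 K / (M n). *)
  have -> : u * (a - b) = (u * a - v * b) - (u - v) * b by ring.
  rewrite (le_trans (ler_normB _ _))// normrM [`|b|]ger0_norm; last lra.
  have : `|u - v| * b <= `|u - v| by rewrite -[leRHS]mulr1 ler_wpM2l//; lra.
  have : 4 * K / N%:R = 2 * K / N%:R + 2 * K / N%:R by field; rewrite gt_eqF.
  by lra.
have : del * n%:R^-1 <= u * `|a - b| by rewrite ler_pM// ?invr_ge0 ltW.
move=> h1 h2; have := le_trans h1 h2.
rewrite ler_pdivlMr// /N natrM.
have -> : del / n%:R * (M%:R * n%:R) = M%:R * del by field; rewrite gt_eqF.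
by lra.
Qed.

(** Directions are normalized by Re c = 1, which gives |c| >= 1 and leaves three real parameters. If
    (f, g) = l (eps, c) then Re g = l, and the other three real coordinates divided by Re g are
    these parameters, up to the factor [eta']. *)
Lemma generic_direction (f g : zpoly R) (r eta : R) : 0 < r -> 0 < eta ->
  (forall z, ~ (ev f z = 0 /\ ev g z = 0)) ->
  exists eps c : C, [/\ cabs eps <= eta, 1 <= cabs c &
    forall z (l : R), cabs z <= r -> 0 < l ->
      ~ (ev f z = l%:C * eps /\ ev g z = l%:C * c)].
Proof.
move=> r0 eta0 fg0.
have [Lf Lf0 hf] := ev_lipschitz f (2 * r).
have [Lg Lg0 hg] := ev_lipschitz g (2 * r).
(* Halved because |eps| is estimated by |Re eps| + |Im eps|, each at most [eta']. *)
pose eta' := eta / 2; have eta'0 : 0 < eta' by rewrite divr_gt0.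
(* Carries the unit square onto the square circumscribed about the disk of radius [r]; this square
   lies in the disk of radius 2 r. *)
pose pt (x y : R) : C := (r * (2 * x - 1)) +i* (r * (2 * y - 1)).
have pt_in x y : 0 <= x <= 1 -> 0 <= y <= 1 -> cabs (pt x y) <= 2 * r.
  move=> x01 y01; rewrite (le_trans (ler_cabs_ReIm _))//= !normrM gtr0_norm//.
  have /ler_wpM2l : `|2 * x - 1| <= 1 by rewrite ler_norml; lra.
  move=> /(_ r (ltW r0)).
  have /ler_wpM2l : `|2 * y - 1| <= 1 by rewrite ler_norml; lra.
  move=> /(_ r (ltW r0)); lra.
have pt_lip x y x' y' : cabs (pt x y - pt x' y') <= 2 * r * (`|x - x'| + `|y - y'|).
  rewrite (le_trans (ler_cabs_ReIm _))//=.
  have -> : r * (2 * x - 1) - r * (2 * x' - 1) = 2 * r * (x - x') by ring.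
  have -> : r * (2 * y - 1) - r * (2 * y' - 1) = 2 * r * (y - y') by ring.
  by rewrite !normrM [`|2|]gtr0_norm// [`|r|]gtr0_norm// mulrDr.
pose K := (Lf / eta' + Lf + Lg + 1) * (2 * r).
have Le0 : 0 <= Lf / eta' by rewrite divr_ge0// ltW.
have K0 : 0 < K by rewrite mulr_gt0 ?mulr_gt0//; lra.
pose h0 x y := complex.Re (ev g (pt x y)).
pose h (i : 'I_3) x y := if i == 0 then complex.Re (ev f (pt x y)) / eta' else
  if i == 1 then complex.Im (ev f (pt x y)) / eta' else complex.Im (ev g (pt x y)).
have lipK (F : R -> R -> R) (L : R) : 0 <= L -> L <= Lf / eta' + Lf + Lg + 1 ->
    (forall x y x' y', 0 <= x <= 1 -> 0 <= y <= 1 -> 0 <= x' <= 1 -> 0 <= y' <= 1 ->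
      `|F x y - F x' y'| <= L * cabs (pt x y - pt x' y')) -> lipschitz_square K F.
  move=> L0 LK FL x y x' y' *; rewrite (le_trans (FL _ _ _ _ _ _ _ _))//.
  rewrite /K -mulrA; apply: ler_pM => //; first exact: cabs_ge0.
have lip0 : lipschitz_square K h0.
  apply: (lipK _ Lg); rewrite //; first lra.
  move=> x y x' y' *; rewrite /h0 -raddfB (le_trans (ler_Re_cabs _))//.
  by apply: hg; apply: pt_in.
have liph i : lipschitz_square K (h i).
  rewrite /h; case: (i == 0); last case: (i == 1).
  - apply: (lipK _ (Lf / eta')); rewrite //; first lra.
    move=> x y x' y' *; rewrite -mulrBl -raddfB normrM [`|eta'^-1|]gtr0_norm ?invr_gt0//.
    rewrite mulrAC ler_pM2r ?invr_gt0// (le_trans (ler_Re_cabs _))//.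
    by apply: hf; apply: pt_in.
  - apply: (lipK _ (Lf / eta')); rewrite //; first lra.
    move=> x y x' y' *; rewrite -mulrBl -raddfB normrM [`|eta'^-1|]gtr0_norm ?invr_gt0//.
    rewrite mulrAC ler_pM2r ?invr_gt0// (le_trans (ler_Im_cabs _))//.
    by apply: hf; apply: pt_in.
  - apply: (lipK _ Lg); rewrite //; first lra.
    move=> x y x' y' *; rewrite -raddfB (le_trans (ler_Im_cabs _))//.
    by apply: hg; apply: pt_in.
(* If the four real coordinates vanished together, the point would be a common zero of [f] and
   [g]. *)
have [del del0 hdel] : exists2 del : R, 0 < del & forall x y, 0 <= x <= 1 ->
    0 <= y <= 1 -> del <= `|h0 x y| + \sum_i `|h i x y|.
  apply: (@lipschitz_square_min (K * 4)); first by rewrite mulr_gt0.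
    move=> x y x' y' x01 y01 x'01 y'01.
    rewrite opprD addrACA -sumrB (le_trans (ler_normD _ _))//.
    set D := `|x - x'| + _.
    have -> : K * 4 * D = K * D + \sum_(i < 3) K * D.
      by rewrite sumr_const card_ord; ring.
    apply: lerD; first by rewrite (le_trans (ler_dist_dist _ _))// lip0.
    rewrite (le_trans (ler_norm_sum _ _ _))//; apply: ler_sum => i _.
    by rewrite (le_trans (ler_dist_dist _ _))// liph.
  move=> x y _ _; rewrite lt_def addr_ge0 ?sumr_ge0// andbT.
  rewrite paddr_eq0 ?sumr_ge0// psumr_eq0//; apply/negP => /andP[g0 /allP hz].
  apply: (fg0 (pt x y)).
  have := hz 0 (mem_index_enum _); have := hz 1 (mem_index_enum _).
  have := hz 2%:R (mem_index_enum _); rewrite /h /=.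
  rewrite !normr_eq0 !mulf_eq0 !invr_eq0 (gt_eqF eta'0) !orbF => g1 f1 f0.
  rewrite normr_eq0 in g0.
  by split; apply/eqP; rewrite eq_complex /= ?f0 ?f1 ?g0 ?g1.
(* Where the three [h i] are bounded by [h0], the sum of the four moduli is at most 4 [h0]. *)
have del4 : 0 < del / 4 by lra.
have [|a a01 avoid] := lipschitz_square_avoid K0 del4 lip0 liph.
  move=> x y x01 y01 hle; have := hdel x y x01 y01.
  have h00 : 0 <= h0 x y by apply: le_trans (hle 0).
  rewrite ger0_norm// !big_ord_recl big_ord0.
  have := hle ord0; have := hle (lift ord0 ord0); have := hle (lift ord0 (lift ord0 ord0)).
  lra.
exists ((eta' * a 0) +i* (eta' * a 1)), (1 +i* a 2%:R); split.
- rewrite (le_trans (ler_cabs_ReIm _))//= 2!(normrM eta') (gtr0_norm eta'0) -mulrDr.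
  have := a01 0; have := a01 1 => /andP[p0 p1] /andP[q0 q1].
  rewrite !ger0_norm//.
  rewrite [leRHS](_ : _ = eta' * 2); last by rewrite /eta'; field.
  by rewrite ler_pM2l//; lra.
- by apply: le_trans (ler_Re_cabs _); rewrite /= normr1.
move=> z l zr l0 [fz gz].
have r2 : 0 < 2 * r by rewrite mulr_gt0.
pose x := (complex.Re z / r + 1) / 2; pose y := (complex.Im z / r + 1) / 2.
have x01 : 0 <= x <= 1.
  have : `|complex.Re z / r| <= 1.
    rewrite normrM [`|r^-1|]gtr0_norm ?invr_gt0// ler_pdivrMr// mul1r.
    exact: le_trans (ler_Re_cabs _) zr.
  by rewrite ler_norml /x; lra.
have y01 : 0 <= y <= 1.
  have : `|complex.Im z / r| <= 1.
    rewrite normrM [`|r^-1|]gtr0_norm ?invr_gt0// ler_pdivrMr// mul1r.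
    exact: le_trans (ler_Im_cabs _) zr.
  by rewrite ler_norml /y; lra.
have ptz : pt x y = z.
  rewrite /pt /x /y; case: (z) => p q /=; congr (_ +i* _); field; exact: lt0r_neq0.
have h0z : h0 x y = l by rewrite /h0 ptz gz /=; ring.
apply: (avoid x y x01 y01); first by rewrite h0z.
have e0 : eta' != 0 := lt0r_neq0 eta'0.
move=> i; rewrite h0z /h ptz fz gz /=.
case: ifP => [/eqP ->|i0]; first by field.
case: ifP => [/eqP ->|i1]; first by field.
have -> : i = 2%:R by move: i i0 i1 => [[|[|[|i]]] hi]//= *; apply: val_inj.
by ring.
Qed.

End GenericDirection.

(** * Winding numbers *)

Section Winding.
Variable R : realType.
Local Notation C := R[i].

Lemma expiD (a b : R) : expi (a + b) = expi a * expi b.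
Proof. by rewrite /expi cosD sinD; congr (_ +i* _); rewrite addrC. Qed.

Lemma expi0 : expi 0 = 1 :> C.
Proof. by rewrite /expi cos0 sin0. Qed.

Lemma expi_pi2 : expi (2 * pi) = 1 :> C.
Proof. by rewrite mulr_natl /expi cos2pi sin2pi. Qed.

Lemma expiNl (a : R) : expi a * expi (- a) = 1.
Proof. by rewrite -expiD subrr expi0. Qed.

Lemma cabs_expi (a : R) : cabs (expi a) = 1.
Proof. by rewrite /cabs /expi cos2Dsin2 sqrtr1. Qed.

Lemma expi_neq0 (a : R) : expi a != 0.
Proof. by rewrite -cabs_gt0 cabs_expi. Qed.

Lemma sqr_cabs (z : C) : cabs z ^+ 2 = complex.Re z ^+ 2 + complex.Im z ^+ 2.
Proof. by case: z => a b; rewrite /cabs sqr_sqrtr ?addr_ge0 ?sqr_ge0. Qed.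

(** The angle is the arc cosine of Re c / |c|, with the sign of Im c. *)
Lemma polar_form (c : C) : exists theta, c = (cabs c)%:C * expi theta.
Proof.
have [->|c0] := eqVneq c 0; first by exists 0; rewrite cabs0 mul0r.
have r0 : 0 < cabs c by rewrite cabs_gt0.
pose x := complex.Re c / cabs c; pose y := complex.Im c / cabs c.
have xy1 : 1 - x ^+ 2 = y ^+ 2.
  apply/eqP; rewrite subr_eq eq_sym /x /y !exprMn exprVn -mulrDl addrC -sqr_cabs.
  by rewrite divff// expf_neq0// lt0r_neq0.
have x1 : -1 <= x <= 1.
  rewrite -ler_norml normrM [`|_^-1|]gtr0_norm ?invr_gt0// ler_pdivrMr// mul1r.
  exact: ler_Re_cabs.
have cosx : cos (acos x) = x by have [] := acos_def x1.
have sinx : sin (acos x) = `|y| by rewrite -sqrtr_sqr -xy1; exact: sin_acos.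
have cE : c = (cabs c)%:C * (x +i* y).
  apply/eqP; rewrite eq_complex /=; apply/andP.
  by split; apply/eqP; rewrite /x /y; field; exact: lt0r_neq0.
have [y0|y0] := leP 0 y.
  by exists (acos x); rewrite /expi cosx sinx ger0_norm.
by exists (- acos x); rewrite /expi cosN sinN cosx sinx ltr0_norm// opprK.
Qed.

(** A winding number over [0, 2 pi] whose argument is continuous on the whole line: this avoids
    subspace topologies when arguments are added. *)
Definition total_arg (gamma : R -> C) (n : int) : Prop :=
  exists theta : R -> R, [/\ continuous theta, forall t, gamma t != 0,
    forall t, gamma t = (cabs (gamma t))%:C * expi (theta t) &
    theta (2 * pi) - theta 0 = 2 * pi * n%:~R].

Lemma total_arg_winding gamma n :
  total_arg gamma n -> winding_number gamma 0 (2 * pi) n.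
Proof.
move=> [theta [cth g0 gE dth]]; exists theta; split=> //.
exact: continuous_subspaceT.
Qed.

Lemma total_arg_ext gamma gamma' n :
  gamma =1 gamma' -> total_arg gamma n -> total_arg gamma' n.
Proof. by move=> /funext ->. Qed.

Lemma total_argM gamma gamma' n n' : total_arg gamma n -> total_arg gamma' n' ->
  total_arg (fun t => gamma t * gamma' t) (n + n').
Proof.
move=> [th [c g0 gE d]] [th' [c' g'0 g'E d']].
exists (fun t => th t + th' t); split=> [t|t|t|].
- by apply: continuousD; [exact: c|exact: c'].
- by rewrite mulf_neq0.
- by rewrite cabsM rmorphM /= expiD mulrACA -gE -g'E.
- by rewrite opprD addrACA d d' -mulrDr intrD.
Qed.

Lemma total_arg_cst (c : C) : c != 0 -> total_arg (fun=> c) 0.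
Proof.
move=> c0; have [th cE] := polar_form c.
by exists (fun=> th); split=> [t|//|//|]; [exact: cst_continuous|rewrite subrr mulr0].
Qed.

Lemma total_arg_expi : total_arg (@expi R) 1.
Proof.
exists id; split=> [t|t|t|]; first exact: cvg_id.
- exact: expi_neq0.
- by rewrite cabs_expi mul1r.
- by rewrite subr0 mulr1.
Qed.

Lemma total_arg_expiN : total_arg (fun t => expi (- t)) (- 1).
Proof.
exists -%R; split=> [t|t|t|]; first exact: opp_continuous.
- exact: expi_neq0.
- by rewrite cabs_expi mul1r.
- by rewrite oppr0 subr0 mulrN mulr1.
Qed.

(** In the right half-plane atan(b/a) is a single-valued continuous argument, so it returns to its
    initial value. *)
Lemma total_arg_right_half_plane (a b : R -> R) : continuous a -> continuous b ->
  (forall t, 0 < a t) -> a (2 * pi) = a 0 -> b (2 * pi) = b 0 ->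
  total_arg (fun t => a t +i* b t) 0.
Proof.
move=> ca cb a0 aE bE.
exists (fun t => atan (b t / a t)); split=> [t|t|t|].
- apply: (@continuous_comp _ _ _ (fun t => b t / a t) atan); last exact: continuous_atan.
  by apply: continuousM; [exact: cb|apply: continuousV; [exact: lt0r_neq0|exact: ca]].
- by rewrite eq_complex /= negb_and lt0r_neq0.
- have s0 : 0 < Num.sqrt (1 + (b t / a t) ^+ 2).
    by rewrite sqrtr_gt0 ltr_pwDl// sqr_ge0.
  have cosE : cos (atan (b t / a t)) = (Num.sqrt (1 + (b t / a t) ^+ 2))^-1.
    exact: cos_atan.
  have sinE : sin (atan (b t / a t)) = b t / a t * (Num.sqrt (1 + (b t / a t) ^+ 2))^-1.
    rewrite -cosE -{2}(atanK (b t / a t)) /tan divfK// cosE.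
    by rewrite invr_neq0// lt0r_neq0.
  have rE : cabs (a t +i* b t) = a t * Num.sqrt (1 + (b t / a t) ^+ 2).
    rewrite -[X in _ = X * _](gtr0_norm (a0 t)) -sqrtr_sqr -sqrtrM ?sqr_ge0// /cabs; congr Num.sqrt.
    by field; exact: lt0r_neq0.
  rewrite rE /expi cosE sinE; apply/eqP; rewrite eq_complex /=; apply/andP; split.
    by apply/eqP; field; rewrite !lt0r_neq0.
  by apply/eqP; field; rewrite !lt0r_neq0.
- by rewrite aE bE subrr mulr0.
Qed.

(** The curve stays within distance |r| < 1 of 1, hence in the right half-plane. It is applied with
    m = 1 and m = -1. *)
Lemma total_arg_sub_expi (r : C) (m : R) : cabs r < 1 -> expi (m * (2 * pi)) = 1 ->
  total_arg (fun t => 1 - r * expi (m * t)) 0.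
Proof.
move=> r1 m1; case: r r1 => p q r1.
pose a t := 1 - (p * cos (m * t) - q * sin (m * t)).
pose b t := - (p * sin (m * t) + q * cos (m * t)).
have ccos : continuous (fun t : R => cos (m * t)).
  move=> t; apply: (@continuous_comp _ _ _ ( *%R m) cos); last exact: continuous_cos.
  exact: mulrl_continuous.
have csin : continuous (fun t : R => sin (m * t)).
  move=> t; apply: (@continuous_comp _ _ _ ( *%R m) sin); last exact: continuous_sin.
  exact: mulrl_continuous.
have E t : a t +i* b t = 1 - (p +i* q) * expi (m * t).
  by apply/eqP; rewrite eq_complex /= /a /b; apply/andP; split; apply/eqP; ring.
apply: (total_arg_ext E).
have [cE sE] : cos (m * (2 * pi)) = 1 /\ sin (m * (2 * pi)) = 0 by case: m1.
apply: total_arg_right_half_plane.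
- move=> t; apply: cvgB; first exact: cvg_cst.
  by apply: cvgB; (apply: cvgM; first exact: cvg_cst); [exact: ccos|exact: csin].
- move=> t; apply: cvgN.
  by apply: cvgD; (apply: cvgM; first exact: cvg_cst); [exact: csin|exact: ccos].
- move=> t; have := ler_Re_cabs ((p +i* q) * expi (m * t)).
  by rewrite cabsM cabs_expi mulr1 /= ler_norml /a; lra.
- by rewrite /a cE sE (mulr0 m) cos0 sin0.
- by rewrite /b cE sE (mulr0 m) cos0 sin0.
Qed.

(** For |r| < 1 factor out e^(it), for |r| > 1 factor out -r; what remains does not wind. The
    boolean is read as the integer 0 or 1. *)
Lemma total_arg_linear_factor (r : C) : cabs r != 1 ->
  total_arg (fun t => expi t - r) (cabs r < 1)%R.
Proof.
move=> r1; have [rlt|rgt] := ltP (cabs r) 1.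
  have E t : expi t * (1 - r * expi (-1 * t)) = expi t - r.
    by rewrite mulN1r mulrBr mulr1 mulrCA expiNl mulr1.
  apply: (total_arg_ext E); rewrite -[X in total_arg _ X](addr0).
  apply: (total_argM total_arg_expi); apply: total_arg_sub_expi => //.
  by rewrite mulN1r -[LHS]mul1r -{1}expi_pi2 expiNl.
have {r1}rgt : 1 < cabs r by rewrite lt_def r1.
have r0 : r != 0 by rewrite -cabs_gt0; lra.
have E t : - r * (1 - r^-1 * expi (1 * t)) = expi t - r.
  by rewrite mul1r; field.
apply: (total_arg_ext E); rewrite -[X in total_arg _ X](addr0).
apply: total_argM; first by apply: total_arg_cst; rewrite oppr_eq0.
apply: total_arg_sub_expi; last by rewrite mul1r expi_pi2.
by rewrite cabsV invf_lt1//; lra.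
Qed.

Lemma total_arg_prod (rs : seq C) : all (fun r => cabs r != 1) rs ->
  total_arg (fun t => \prod_(r <- rs) (expi t - r)) (count (fun r => cabs r < 1) rs).
Proof.
elim: rs => [_|r rs IH /= /andP[r1 /IH {}IH]].
  by apply: total_arg_ext (total_arg_cst (oner_neq0 _)) => t; rewrite big_nil.
rewrite PoszD.
by apply: total_arg_ext (total_argM (total_arg_linear_factor r1) IH) => t; rewrite big_cons.
Qed.

Lemma total_arg_expiNX d : total_arg (fun t => expi (- t) ^+ d) (- d%:Z).
Proof.
elim: d => [|d IH].
  by apply: total_arg_ext (total_arg_cst (oner_neq0 _)) => t.
rewrite -addn1 addnC PoszD opprD.
by apply: total_arg_ext (total_argM total_arg_expiN IH) => t; rewrite exprS.
Qed.

End Winding.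

(** * Deformation to a standard map *)

Section Homotopies.
Variable R : realType.
Local Notation C := R[i].

Definition affine_ext (P : C -> C) (x : sphere R) : sphere R :=
  if x is Some z then Some (P z) else None.

Lemma proj1 (p : C) : proj p 1 = Some p.
Proof. by rewrite /proj oner_eq0 divr1. Qed.

Lemma proj0 (p : C) : proj p 0 = None.
Proof. by rewrite /proj eqxx. Qed.

Lemma homotopic_ext (F F' G G' : sphere R -> sphere R) :
  F =1 F' -> G =1 G' -> homotopic F G -> homotopic F' G'.
Proof. by move=> /funext -> /funext ->. Qed.

Definition tends_to_infty (P : R -> C -> C) : Prop :=
  forall B : R, exists M : R, forall t z, 0 <= t <= 1 -> M < cabs z -> B < cabs (P t z).

Lemma tends_to_infty_neq0 P s : tends_to_infty P ->
  nbhs_strip_infty s [set x : R * C | P x.1 x.2 != 0].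
Proof.
move=> /(_ 0) [M PM]; exists 1 => //; exists M => t w t01 _ /= Mw.
by rewrite -cabs_gt0 PM.
Qed.

Lemma clim_inv_infty P s : tends_to_infty P ->
  clim (nbhs_strip_infty s) (fun x : R * C => (P x.1 x.2)^-1) 0.
Proof.
move=> Pinf e e0; have [M PM] := Pinf e^-1; exists 1 => //; exists M => t w t01 _ /= Mw.
have h := PM t w t01 Mw; rewrite subr0 cabsV invf_plt ?posrE// (lt_trans _ h)//.
by rewrite invr_gt0.
Qed.

(** The pair (P, 1) has no common zero, and 1/P tends to 0 at infinity. *)
Lemma affine_homotopy (P : R -> C -> C) :
  (forall s z, 0 <= s <= 1 -> clim (nbhs_strip s z) (fun x => P x.1 x.2) (P s z)) ->
  tends_to_infty P ->
  homotopic (affine_ext (P 0)) (affine_ext (P 1)).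
Proof.
move=> Pc Pinf.
apply: homotopic_ext (@pair_homotopy _ P (fun _ _ => 1) (fun=> 0) Pc _ _ _ _ _).
- by case=> [z|]; rewrite /= ?proj1 ?proj0.
- by case=> [z|]; rewrite /= ?proj1 ?proj0.
- by move=> s z _; apply: clim_cst.
- by move=> s z _; right; apply: oner_neq0.
- by move=> s _; apply: tends_to_infty_neq0.
- move=> s _; apply: clim_ext (clim_inv_infty s Pinf) => x; rewrite mul1r//.
- by move=> s _; apply: clim_cst.
Qed.

(** Covers both the translation of the pair and the later shrinking of [g]. Dividing by [f], which
    tends to infinity, removes all additive constants from the limit of Q/P. *)
Lemma pencil_homotopy (f g : zpoly R) (q0 a0 a1 b0 b1 c0 c1 : C) :
  tends_to_infty (fun _ => ev f) ->
  (forall s, clim (nbhs_strip_infty s) (fun x => ev g x.2 / ev f x.2) q0) ->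
  let P (s : R) z := ev f z - (a0 + s%:C * a1) in
  let Q (s : R) z := (b0 + s%:C * b1) * ev g z - (c0 + s%:C * c1) in
  let q (s : R) := (b0 + s%:C * b1) * q0 in
  (forall s z, 0 <= s <= 1 -> P s z != 0 \/ Q s z != 0) ->
  homotopic (proj_ext (P 0) (Q 0) (q 0)) (proj_ext (P 1) (Q 1) (q 1)).
Proof.
move=> finf wq P Q q PQ0.
have lin_strip s z (k0 k1 : C) :
    clim (nbhs_strip s z) (fun x => k0 + x.1%:C * k1) (k0 + s%:C * k1).
  by apply: climD; [exact: clim_cst|apply: climM; [exact: clim_strip_time|exact: clim_cst]].
have lin_infty s (k0 k1 : C) :
    clim (nbhs_strip_infty s) (fun x => k0 + x.1%:C * k1) (k0 + s%:C * k1).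
  by apply: climD; [exact: clim_cst|apply: climM; [exact: clim_strip_infty_time|exact: clim_cst]].
have Pinf : tends_to_infty P.
  move=> B; have [M fM] := finf (B + cabs a0 + cabs a1); exists M => t z t01 Mz.
  have h := fM 0 z (andb_true_intro (conj (lexx 0) ler01)) Mz.
  have h1 := lerB_cabsD (ev f z) (- (a0 + t%:C * a1)).
  have h2 := ler_cabsD a0 (t%:C * a1).
  have h3 : cabs (t%:C * a1) <= cabs a1.
    rewrite cabsM cabs_real ger0_norm; last lra.
    by rewrite -[leRHS]mul1r ler_wpM2r ?cabs_ge0//; lra.
  by rewrite cabsN in h1; rewrite /P; lra.
apply: pair_homotopy => // [s z s01|s z s01|s s01|s s01|s s01].
- by apply: climB => //; apply: clim_ev; apply: clim_strip_point.
- by apply: climB => //; apply: climM => //; apply: clim_ev; apply: clim_strip_point.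
- exact: tends_to_infty_neq0.
- have h0 := clim_inv_infty s finf.
  have num : clim (nbhs_strip_infty s) (fun x : R * C =>
      (b0 + x.1%:C * b1) * (ev g x.2 / ev f x.2) - (c0 + x.1%:C * c1) * (ev f x.2)^-1)
      ((b0 + s%:C * b1) * q0 - (c0 + s%:C * c1) * 0).
    by apply: climB; apply: climM.
  have den : clim (nbhs_strip_infty s) (fun x : R * C =>
      1 - (a0 + x.1%:C * a1) * (ev f x.2)^-1) (1 - (a0 + s%:C * a1) * 0).
    by apply: climB; [exact: clim_cst|apply: climM].
  rewrite mulr0 subr0 in den; rewrite mulr0 subr0 in num.
  have := climM num (climV (oner_neq0 _) den); rewrite invr1 mulr1.
  rewrite -/(q s) => lim; apply: clim_near (lim _ _).
  have := tends_to_infty_neq0 s finf; apply: filter_app.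
  have := tends_to_infty_neq0 s Pinf; apply: filterS => -[t z] /=.
  rewrite /P /Q /= => P0 f0.
  have -> : 1 - (a0 + t%:C * a1) / ev f z = (ev f z - (a0 + t%:C * a1)) / ev f z by field.
  by field; rewrite f0 P0.
- by apply: climM => //; apply: clim_cst.
Qed.

(** The pairs (f, (1-s) g + s f) keep a nonzero first coordinate and end at [f : f] = 1. *)
Lemma nonvanishing_homotopy (f g : zpoly R) (q0 : C) :
  (forall z, ev f z != 0) ->
  (forall s, clim (nbhs_strip_infty s) (fun x => ev g x.2 / ev f x.2) q0) ->
  homotopic (proj_ext (ev f) (ev g) q0) (fun=> Some 1).
Proof.
move=> f0 wq.
apply: homotopic_ext (@pair_homotopy _ (fun=> ev f)
  (fun (s : R) z => (1 - s%:C) * ev g z + s%:C * ev f z)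
  (fun s : R => (1 - s%:C) * q0 + s%:C) _ _ _ _ _ _).
- by case=> [z|]; rewrite /= rmorph0 ?mul0r subr0 mul1r addr0.
- case=> [z|]; rewrite /= rmorph1 subrr !mul0r add0r ?mul1r ?proj1//.
  by rewrite -{1}(mulr1 (ev f z)) -{2}(mulr1 (ev f z)) projZ// proj1.
- by move=> s z _; apply: clim_ev; apply: clim_strip_point.
- move=> s z _; have tc := @clim_strip_time R s z.
  have fc p : clim (nbhs_strip s z) (fun x => ev p x.2) (ev p z).
    by apply: clim_ev; apply: clim_strip_point.
  by apply: climD; apply: climM => //; apply: climB => //; apply: clim_cst.
- by move=> s z _; left.
- by move=> s _; exists 1 => //; exists 0 => t w _ _ _; apply: f0.
- move=> s _; have tc := @clim_strip_infty_time R s.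
  have : clim (nbhs_strip_infty s) (fun x : R * C =>
      (1 - x.1%:C) * (ev g x.2 / ev f x.2) + x.1%:C) ((1 - s%:C) * q0 + s%:C).
    by apply: climD => //; apply: climM => //; apply: climB => //; apply: clim_cst.
  by apply: clim_ext => x; field; apply: f0.
- move=> s _; have tc := @clim_strip_infty_time R s.
  apply: climD => //; apply: climM; last exact: clim_cst.
  by apply: climB => //; apply: clim_cst.
Qed.

(** Equal to 0 at 0, by the convention on division, and discontinuous there. *)
Definition dir (z : C) : C := z / (cabs z)%:C.

Lemma cabs_dir z : z != 0 -> cabs (dir z) = 1.
Proof.
rewrite -cabs_gt0 => z0; rewrite cabsM cabsV cabs_real ger0_norm ?cabs_ge0//.
by rewrite divff// lt0r_neq0.
Qed.

Lemma cabs_dir_le z : cabs (dir z) <= 1.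
Proof.
by have [->|/cabs_dir->//] := eqVneq z 0; rewrite /dir mul0r cabs0.
Qed.

Lemma dirE z : z = (cabs z)%:C * dir z.
Proof.
have [->|z0] := eqVneq z 0; first by rewrite cabs0 mul0r.
by rewrite mulrC divfK// -cabsE normr_eq0.
Qed.

Lemma conj_dir_mul z : z^* * dir z = (cabs z)%:C.
Proof.
have [->|z0] := eqVneq z 0; first by rewrite /dir mul0r mulr0 cabs0.
rewrite /dir mulrA (mulrC _ z) -sqr_normc cabsE expr2 mulfK//.
by rewrite -cabsE normr_eq0.
Qed.

Lemma clim_dir s z : z != 0 -> clim (nbhs_strip s z) (fun x => dir x.2) (dir z).
Proof.
move=> z0; have zc := @clim_strip_point R s z.
apply: climM => //; apply: climV; first by rewrite -cabsE normr_eq0.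
exact: clim_cabs.
Qed.

(** At 0 the power of the conjugate tends to 0 and [B] is bounded, which absorbs the discontinuity
    of [dir]. *)
Lemma clim_conj_dir d (B : R -> C -> C) (K : R) : (0 < d)%N ->
  (forall s z, 0 <= s <= 1 -> z != 0 ->
     clim (nbhs_strip s z) (fun x => B x.1 (dir x.2)) (B s (dir z))) ->
  (forall s u, 0 <= s <= 1 -> cabs u <= 1 -> cabs (B s u) <= K) ->
  forall s z, 0 <= s <= 1 ->
    clim (nbhs_strip s z) (fun x => (x.2^*) ^+ d * B x.1 (dir x.2))
      ((z^*) ^+ d * B s (dir z)).
Proof.
move=> d0 Bc BK s z s01; have zc := @clim_strip_point R s z.
have zd : clim (nbhs_strip s z) (fun x => (x.2^*) ^+ d) ((z^*) ^+ d).
  by apply: climX; apply: clim_conj.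
have [z0|z0] := eqVneq z 0; last by apply: climM zd (Bc s z s01 z0).
have E0 : (z^*) ^+ d = 0 by rewrite z0 rmorph0 expr0n gtn_eqF.
rewrite E0 mul0r; rewrite E0 in zd; apply: (climMbounded (K := K)) zd _.
by exists 1 => // t w t01 _ _ /=; apply: BK => //; apply: cabs_dir_le.
Qed.

(** An inner root becomes (1-s) r. An outer one becomes r/(1-s), with the factor rescaled so as to
    have the limit -r. Neither crosses the unit circle: the lower bound there is uniform in [s]. *)
Lemma root_homotopy_bounds (r u : C) (s : R) : 0 <= s <= 1 ->
  let phi := if cabs r < 1 then u - (1 - s%:C) * r else (1 - s%:C) * u - r in
  (cabs u <= 1 -> cabs phi <= 1 + cabs r) /\
  (cabs u = 1 -> `|1 - cabs r| <= cabs phi).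
Proof.
move=> s01 phi; have r0 := cabs_ge0 r; have u0 := cabs_ge0 u.
have sE : cabs (1 - s%:C) = 1 - s.
  have -> : 1 - s%:C = (1 - s)%:C by rewrite rmorphB rmorph1.
  by rewrite cabs_real ger0_norm//; lra.
have small (x : R) : 0 <= x -> (1 - s) * x <= x.
  by move=> x0; rewrite -[leRHS]mul1r ler_wpM2r//; lra.
rewrite /phi; case: ltP => r1.
  have h1 := ler_cabsB u ((1 - s%:C) * r); have h2 := lerB_cabsD u (- ((1 - s%:C) * r)).
  rewrite cabsN in h2; rewrite cabsM sE in h1 h2; have := small _ r0.
  by split=> uE; [lra|rewrite ger0_norm; lra].
have h1 := ler_cabsB ((1 - s%:C) * u) r.
have h2 := lerB_cabsD (- r) ((1 - s%:C) * u).
rewrite cabsN (addrC (- r)) in h2; rewrite cabsM sE in h1 h2; have := small _ u0.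
by split=> uE; [lra|rewrite ler0_norm; lra].
Qed.

Lemma root_homotopy (k : C) (d : nat) (rs : seq C) : k != 0 -> (0 < d)%N ->
  all (fun r => cabs r != 1) rs ->
  homotopic
    (affine_ext (fun z => (z^*) ^+ d * (k * \prod_(r <- rs) (dir z - r))))
    (affine_ext (fun z => (z^*) ^+ d * (k * \prod_(r <- rs)
       if cabs r < 1 then dir z else - r))).
Proof.
move=> k0 d0 rs1.
pose phi (s : R) (r u : C) :=
  if cabs r < 1 then u - (1 - s%:C) * r else (1 - s%:C) * u - r.
pose B s u := k * \prod_(r <- rs) phi s r u.
apply: homotopic_ext (@affine_homotopy (fun s z => (z^*) ^+ d * B s (dir z)) _ _).
- case=> [z|//] /=; congr (Some (_ * (_ * _))); apply: eq_bigr => r _.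
  by rewrite /phi rmorph0 subr0 !mul1r; case: ifP.
- case=> [z|//] /=; congr (Some (_ * (_ * _))); apply: eq_bigr => r _.
  by rewrite /phi rmorph1 subrr !mul0r subr0 sub0r.
- apply: (clim_conj_dir (K := cabs k * \prod_(r <- rs) (1 + cabs r))) => //.
    move=> s z s01 z0; apply: climM; first exact: clim_cst.
    have dc := clim_dir s z0; have tc := @clim_strip_time R s z.
    apply: clim_prod => r; rewrite /phi; case: (cabs r < 1).
      apply: climB => //; apply: climM; last exact: clim_cst.
      by apply: climB => //; apply: clim_cst.
    apply: climB; last exact: clim_cst.
    by apply: climM => //; apply: climB => //; apply: clim_cst.
  move=> s u s01 u1; rewrite cabsM ler_wpM2l ?cabs_ge0// cabs_prod.
  apply: ler_prod => r _; rewrite cabs_ge0 /=.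
  by have [+ _] := root_homotopy_bounds r u s01; apply.
- pose m := cabs k * \prod_(r <- rs) `|1 - cabs r|.
  have m0 : 0 < m.
    rewrite mulr_gt0 ?cabs_gt0// big_seq prodr_gt0// => r /(allP rs1) r1.
    by rewrite normr_gt0 subr_eq0 eq_sym.
  (* For |z| > 1 the modulus is at least m |z|^d >= m |z|. *)
  move=> A; exists (Num.max 1 (`|A| / m)) => s z s01; rewrite gt_max => /andP[z1 zA].
  have z0 : z != 0 by rewrite -cabs_gt0; lra.
  have Bm : m <= cabs (B s (dir z)).
    rewrite cabsM ler_wpM2l ?cabs_ge0// cabs_prod.
    apply: ler_prod => r _; rewrite normr_ge0 /=.
    by have [_] := root_homotopy_bounds r (dir z) s01; apply; apply: cabs_dir.
  rewrite cabsM cabsX cabsJ (le_lt_trans (ler_norm A))//.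
  rewrite ltr_pdivrMr// in zA; apply: (lt_le_trans zA); apply: ler_pM => //.
  - exact: cabs_ge0.
  - exact: ltW.
  by rewrite -[leLHS]expr1 ler_weXn2l// ltW.
Qed.

(** [k] is the product of the [- r] over the roots outside the open disk. *)
Lemma prod_inner_outer (rs : seq C) : exists2 k : C,
  (all (fun r => cabs r != 1) rs -> k != 0) &
  forall u, \prod_(r <- rs) (if cabs r < 1 then u else - r) =
    k * u ^+ count (fun r => cabs r < 1) rs.
Proof.
elim: rs => [|r rs [k k0 kE]].
  by exists 1 => [_|u]; rewrite ?oner_neq0// big_nil mulr1.
have [r1|r1] := ltP (cabs r) 1.
  exists k => [/= /andP[_ /k0]//|u].
  by rewrite big_cons kE /= r1 exprS mulrCA.
exists (- r * k) => [/= /andP[r2 /k0 kn]|u].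
  by rewrite mulf_neq0// oppr_eq0 -cabs_gt0; lra.
by rewrite big_cons kE /= ltNge r1 /= mulrA.
Qed.

Lemma clim_monomial d N s z : (0 < d)%N -> 0 <= s <= 1 ->
  clim (nbhs_strip s z) (fun x => (x.2^*) ^+ d * dir x.2 ^+ N) ((z^*) ^+ d * dir z ^+ N).
Proof.
move=> d0 s01; apply: (@clim_conj_dir d (fun _ u => u ^+ N) 1) => //.
  by move=> s' z' _ z0; apply: climX; apply: clim_dir.
by move=> _ u _ u1; rewrite cabsX exprn_ile1 ?cabs_ge0.
Qed.

Lemma cabs_monomial d N z : z != 0 -> cabs ((z^*) ^+ d * dir z ^+ N) = cabs z ^+ d.
Proof. by move=> z0; rewrite cabsM !cabsX cabsJ cabs_dir// expr1n mulr1. Qed.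

(* The path ((1 - s) b + s)^2, with b a square root of k in the right half-plane, joins
   k to 1 without meeting 0. *)
Lemma constant_homotopy (k : C) d N : k != 0 -> (0 < d)%N ->
  homotopic (affine_ext (fun z => k * ((z^*) ^+ d * dir z ^+ N)))
            (affine_ext (fun z => (z^*) ^+ d * dir z ^+ N)).
Proof.
move=> k0 d0.
have [b bk bre] : exists2 b : C, b ^+ 2 = k & 0 <= complex.Re b.
  have [h|h] := leP 0 (complex.Re (sqrtc k)).
    by exists (sqrtc k) => //; apply: sqr_sqrtc.
  exists (- sqrtc k); first by rewrite sqrrN sqr_sqrtc.
  by rewrite raddfN oppr_ge0 ltW.
have b0 : 0 < cabs b.
  by rewrite cabs_gt0; apply: contraNneq k0 => b0; rewrite -bk b0 expr0n.
(* For s <= 1/2 adding s >= 0 to a nonnegative real part keeps the modulus at least (1-s) |b|; for s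
   > 1/2 the real part alone is at least s. *)
pose c := Num.min (cabs b / 2) (1 / 2).
have c0 : 0 < c by rewrite lt_min; lra.
have path_ge (s : R) : 0 <= s <= 1 -> c <= cabs ((1 - s%:C) * b + s%:C).
  have -> : (1 - s%:C) * b + s%:C =
      ((1 - s) * complex.Re b + s) +i* ((1 - s) * complex.Im b).
    by case: (b) => p q; apply/eqP; rewrite eq_complex /=; apply/andP; split; apply/eqP; ring.
  move=> s01; have bre' : 0 <= (1 - s) * complex.Re b by rewrite mulr_ge0//; lra.
  have [s1|s1] := leP s (1 / 2).
    rewrite ge_min; apply/orP; left.
    have e1 : (1 - s) * cabs b = cabs (((1 - s) * complex.Re b) +i* ((1 - s) * complex.Im b)).
      have -> : ((1 - s) * complex.Re b) +i* ((1 - s) * complex.Im b) = (1 - s)%:C * b.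
        by case: (b) => p q; apply/eqP; rewrite eq_complex /=; apply/andP; split; apply/eqP; ring.
      by rewrite cabsM cabs_real ger0_norm//; lra.
    apply: (@le_trans _ _ ((1 - s) * cabs b)).
      by rewrite mulrC ler_pM2r//; lra.
    rewrite e1 /cabs ler_wsqrtr// lerD2r lerXn2r ?nnegrE//; lra.
  rewrite ge_min; apply/orP; right; apply: le_trans (ler_Re_cabs _) => /=.
  by rewrite ger0_norm; lra.
apply: homotopic_ext (@affine_homotopy (fun s z =>
  ((1 - s%:C) * b + s%:C) ^+ 2 * ((z^*) ^+ d * dir z ^+ N)) _ _).
- by case=> [z|//] /=; rewrite rmorph0 subr0 mul1r addr0 bk.
- by case=> [z|//] /=; rewrite rmorph1 subrr mul0r add0r expr1n mul1r.
- move=> s z s01; have tc := @clim_strip_time R s z.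
  apply: climM; last exact: clim_monomial.
  apply: climX; apply: climD => //; apply: climM; last exact: clim_cst.
  by apply: climB => //; apply: clim_cst.
- move=> A; exists (Num.max 1 (`|A| / c ^+ 2)) => s z s01; rewrite gt_max => /andP[z1 zA].
  have z0 : z != 0 by rewrite -cabs_gt0; lra.
  rewrite cabsM cabs_monomial// cabsX (le_lt_trans (ler_norm A))//.
  rewrite ltr_pdivrMr ?exprn_gt0// mulrC in zA; apply: (lt_le_trans zA); apply: ler_pM => //.
  - by rewrite exprn_ge0// ltW.
  - exact: cabs_ge0.
  - by rewrite lerXn2r ?nnegrE ?path_ge ?cabs_ge0// ltW.
  by rewrite -[leLHS]expr1 ler_weXn2l// ltW.
Qed.

End Homotopies.

(** * Standard maps, limits at infinity and growth *)

Section Degree.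
Variable R : realType.
Local Notation C := R[i].

(** For N different from [d], both maps are positive multiples of one another away from 0, so the
    segment between them avoids 0. For N = d the map is |z|^d, and the pairs (|z|^d + s, 1 + s
    |z|^d) move the image of infinity from infinity to 1 and end at the constant 1. *)
Lemma std_homotopy d N : (0 < d)%N ->
  homotopic (affine_ext (fun z : C => (z^*) ^+ d * dir z ^+ N)) (std_map (N%:Z - d%:Z)).
Proof.
move=> d0; pose mono (z : C) := (z^*) ^+ d * dir z ^+ N.
have straight (t : C -> C) : (forall s z, clim (nbhs_strip s z) (fun x => t x.2) (t z)) ->
    tends_to_infty (fun s z => (1 - s%:C) * mono z + s%:C * t z) ->
    homotopic (affine_ext mono) (affine_ext t).
  move=> tc tinf; apply: homotopic_ext (@affine_homotopy _
    (fun s z => (1 - s%:C) * mono z + s%:C * t z) _ tinf).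
  - by case=> [z|//] /=; rewrite rmorph0 subr0 mul1r mul0r addr0.
  - by case=> [z|//] /=; rewrite rmorph1 subrr mul0r mul1r add0r.
  - move=> s z s01; have sc := @clim_strip_time R s z.
    apply: climD; last by apply: climM.
    apply: climM; last exact: clim_monomial.
    by apply: climB => //; apply: clim_cst.
have real_ge (s x y : R) : 0 <= s <= 1 -> 1 <= x -> 1 <= y ->
    1 <= cabs ((1 - s%:C) * x%:C + s%:C * y%:C).
  move=> s01 x1 y1.
  have -> : (1 - s%:C) * x%:C + s%:C * y%:C = ((1 - s) * x + s * y)%:C.
    by rewrite rmorphD !rmorphM rmorphB rmorph1.
  have : (1 - s) * 1 <= (1 - s) * x by apply: ler_wpM2l => //; lra.
  have : s * 1 <= s * y by apply: ler_wpM2l => //; lra.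
  by rewrite cabs_real => h1 h2; rewrite (le_trans _ (ler_norm _))//; lra.
have [Nd|Nd|Nd] := ltngtP N d.
- pose n := (d - N)%N; have n0 : (0 < n)%N by rewrite subn_gt0.
  have -> : std_map (N%:Z - d%:Z) = affine_ext (fun z : C => (z^*) ^+ n).
    have n0' : (0 <= N%:Z - d%:Z) = false by lia.
    have n1' : (N%:Z - d%:Z == 0) = false by lia.
    by apply/funext => -[z|]; rewrite /std_map ?n0' ?n1'//=; congr (Some (_ ^+ _)); lia.
  apply: straight => [s z|B].
    by apply: climX; apply: clim_conj; apply: clim_strip_point.
  exists (Num.max 1 B) => s z s01; rewrite gt_max => /andP[z1 /lt_le_trans]; apply.
  have -> : mono z = (cabs z ^+ N)%:C * (z^*) ^+ n.
    rewrite /mono -(subnKC (ltnW Nd)) exprD mulrAC -exprMn conj_dir_mul.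
    by rewrite rmorphXn.
  rewrite mulrA -mulrDl cabsM cabsX cabsJ.
  apply: (@le_trans _ _ (cabs z ^+ n)).
    by rewrite -[leLHS]expr1 ler_weXn2l// ltW.
  rewrite -[leLHS]mul1r ler_wpM2r ?exprn_ge0 ?cabs_ge0//.
  by have := real_ge s (cabs z ^+ N) 1 s01; rewrite rmorph1 mulr1; apply => //;
    rewrite exprn_ege1// ltW.
- pose n := (N - d)%N; have n0 : (0 < n)%N by rewrite subn_gt0.
  have -> : std_map (N%:Z - d%:Z) = affine_ext (fun z : C => z ^+ n).
    have n0' : (0 <= N%:Z - d%:Z) = true by lia.
    have n1' : (N%:Z - d%:Z == 0) = false by lia.
    by apply/funext => -[z|]; rewrite /std_map ?n0' ?n1'//=; congr (Some (_ ^+ _)); lia.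
  apply: straight => [s z|B].
    by apply: climX; apply: clim_strip_point.
  exists (Num.max 1 B) => s z s01; rewrite gt_max => /andP[z1 /lt_le_trans]; apply.
  have z0 : z != 0 by rewrite -cabs_gt0; lra.
  (* One factor |z| is set aside to provide the growth; the remaining coefficients of [dir z ^+ n]
     are at least 1. *)
  have -> : mono z = (cabs z)%:C * ((cabs z ^+ d.-1)%:C * dir z ^+ n).
    have NE : N = (d + n)%N by rewrite subnKC// ltnW.
    rewrite /mono [in LHS]NE exprD [LHS]mulrA -exprMn conj_dir_mul.
    by rewrite -{1}(prednK d0) exprS rmorphXn /= !mulrA.
  have -> : z ^+ n = (cabs z)%:C * ((cabs z ^+ n.-1)%:C * dir z ^+ n).
    by rewrite {1}(dirE z) exprMn -{1}(prednK n0) exprS rmorphXn /= !mulrA.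
  rewrite mulrCA (mulrCA s%:C) -mulrDr cabsM cabs_real ger0_norm ?cabs_ge0//.
  rewrite -[leLHS]mulr1 ler_wpM2l ?cabs_ge0// !mulrA -mulrDl cabsM cabsX cabs_dir//.
  by rewrite expr1n mulr1 real_ge// exprn_ege1// ltW.
- have monoE z : mono z = (cabs z ^+ d)%:C.
    by rewrite /mono Nd -exprMn conj_dir_mul rmorphXn.
  have -> : N%:Z - d%:Z = 0 by rewrite Nd subrr.
  have monoc s z : 0 <= s <= 1 -> clim (nbhs_strip s z) (fun x => mono x.2) (mono z).
    by move=> s01; apply: clim_monomial.
  have monoinf : tends_to_infty (fun _ => mono).
    move=> B; exists (Num.max 1 B) => s z _; rewrite gt_max => /andP[z1 /lt_le_trans]; apply.
    rewrite monoE cabs_real ger0_norm ?exprn_ge0 ?cabs_ge0//.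
    by rewrite -[leLHS]expr1 ler_weXn2l// ltW.
  apply: homotopic_ext (@pair_homotopy _ (fun s z => mono z + s%:C)
    (fun s z => 1 + s%:C * mono z) (fun s => s%:C) _ _ _ _ _ _).
  + by case=> [z|] /=; rewrite rmorph0 !(mul0r, addr0, proj1, proj0).
  + case=> [z|] /=; rewrite rmorph1 ?mul1r ?proj1 ?expr0//.
    have h : 1 + mono z != 0.
      rewrite monoE -(rmorph1 (real_complex R)) -rmorphD fmorph_eq0 lt0r_neq0//.
      by rewrite ltr_pwDl// exprn_ge0// cabs_ge0.
    by rewrite (addrC (mono z)) /proj (negbTE h) divff.
  + move=> s z s01; apply: climD; first exact: monoc.
    exact: clim_strip_time.
  + move=> s z s01; apply: climD; first exact: clim_cst.
    by apply: climM; [exact: clim_strip_time|exact: monoc].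
  + move=> s z s01; right.
    rewrite monoE -(rmorph1 (real_complex R)) -rmorphM -rmorphD fmorph_eq0 lt0r_neq0//.
    by rewrite ltr_pwDl// mulr_ge0 ?exprn_ge0 ?cabs_ge0//; lra.
  + move=> s _; have [M PM] := monoinf 0; exists 1 => //; exists M => t w t01 _ /= Mw.
    have := PM t w t01 Mw; rewrite monoE cabs_real ger0_norm ?exprn_ge0 ?cabs_ge0// => h.
    by rewrite -rmorphD fmorph_eq0 lt0r_neq0//; lra.
  + move=> s _; have tc := @clim_strip_infty_time R s.
    have hc := clim_inv_infty s monoinf.
    have num : clim (nbhs_strip_infty s) (fun x => (mono x.2)^-1 + x.1%:C) (0 + s%:C).
      exact: climD.
    have den : clim (nbhs_strip_infty s) (fun x => 1 + x.1%:C * (mono x.2)^-1) (1 + s%:C * 0).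
      by apply: climD; [exact: clim_cst|apply: climM].
    rewrite mulr0 addr0 in den; rewrite add0r in num.
    have := climM num (climV (oner_neq0 _) den); rewrite invr1 mulr1.
    move=> lim; apply: clim_near (lim _ _).
    have [M PM] := monoinf 0; exists 1 => //; exists M => t w t01 _ /= Mw.
    have := PM t w t01 Mw; rewrite monoE cabs_real ger0_norm ?exprn_ge0 ?cabs_ge0// => h.
    have h1 : (cabs w ^+ d)%:C != 0 by rewrite fmorph_eq0 lt0r_neq0.
    have h2 : (cabs w ^+ d)%:C + t%:C != 0 by rewrite -rmorphD fmorph_eq0 lt0r_neq0//; lra.
    have -> : 1 + t%:C / (cabs w ^+ d)%:C =
        ((cabs w ^+ d)%:C + t%:C) / (cabs w ^+ d)%:C by field.
    by field; rewrite h1 h2.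
  + by move=> s _; apply: clim_strip_infty_time.
Qed.

(** Write the value at infinity as [a : b] and w = g/f. As |w| <= W bounds the denominator in
    [chord_proj], continuity gives a w - b -> 0. Then a = 0 would force b = 0, so w tends to b/a. *)
Lemma ratmap_infty (f g : zpoly R) (Rinf : sphere R) (M W : R) :
  (forall z, M < cabs z -> ev f z != 0 /\ cabs (ev g z / ev f z) <= W) ->
  sphere_continuous (ratmap f g Rinf) ->
  exists2 q0 : C, ratmap f g Rinf =1 proj_ext (ev f) (ev g) q0 &
    forall s, clim (nbhs_strip_infty s) (fun x => ev g x.2 / ev f x.2) q0.
Proof.
move=> fgW cont.
have [a [b [ab RE]]] : exists a b : C, (a != 0 \/ b != 0) /\ Rinf = proj a b.
  case: Rinf {cont} => [c|]; last by exists 1, 0; rewrite proj0 oner_neq0; split=> //; left.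
  by exists c, 1; rewrite proj1; split=> //; right; exact: oner_neq0.
have lim0 s : clim (nbhs_strip_infty s) (fun x => a * (ev g x.2 / ev f x.2) - b) 0.
  move=> e e0.
  have W1 : 0 < 1 + W ^+ 2 by rewrite ltr_pwDl// sqr_ge0.
  pose S := Num.sqrt (sqn a b * (1 + W ^+ 2)).
  have S0 : 0 < S by rewrite sqrtr_gt0 mulr_gt0// sqn_gt0.
  have e1 : 0 < e / S by rewrite divr_gt0.
  have [del del0 h] := cont None _ e1.
  exists 1 => //; exists (Num.max M (2 / del)) => t z _ _; rewrite gt_max => /andP[Mz zdel].
  have [f0 wW] := fgW z Mz.
  have near_z : chord None (Some z) < del.
    rewrite /= ltr_pdivrMr; last by rewrite sqrtr_gt0 ltr_pwDl// sqr_ge0.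
    rewrite mulrC -ltr_pdivrMr// (lt_le_trans zdel)//.
    rewrite -{1}(ger0_norm (cabs_ge0 z)) -sqrtr_sqr ler_wsqrtr//; lra.
  have := h _ near_z; rewrite /= RE -/(proj (ev f z) (ev g z)).
  rewrite -(projZ (ev f z) (ev g z) (invr_neq0 f0)) mulVf// (mulrC _ (ev g z)).
  set w := ev g z / ev f z in wW *.
  have one0 : (1 : C) != 0 \/ w != 0 by left; exact: oner_neq0.
  rewrite chord_proj// mul1r subr0.
  have D0 : 0 < Num.sqrt (sqn a b * sqn 1 w) by rewrite sqrtr_gt0 mulr_gt0 ?sqn_gt0.
  have DS : Num.sqrt (sqn a b * sqn 1 w) <= S.
    rewrite ler_wsqrtr// ler_pM2l ?sqn_gt0// /sqn cabs1 expr1n lerD2l.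
    rewrite lerXn2r ?nnegrE ?cabs_ge0//; exact: le_trans (cabs_ge0 w) wW.
  rewrite ltr_pdivrMr// => lt_e.
  have : e / S * Num.sqrt (sqn a b * sqn 1 w) <= e.
    by rewrite mulrAC ler_pdivrMr// ler_pM2l.
  have := cabs_ge0 (a * w - b); lra.
have a0 : a != 0.
  apply/eqP => a0; have b0 : 0 < cabs b.
    by rewrite cabs_gt0; case: ab; rewrite ?a0 ?eqxx.
  have [del del0 [M' h]] := lim0 0 _ b0.
  have Mw : M' < cabs (`|M'| + 1)%:C.
    by rewrite cabs_real ger0_norm ?addr_ge0//; have := ler_norm M'; lra.
  have := h 0 (`|M'| + 1)%:C; rewrite /= lexx ler01 subrr normr0 => /(_ isT del0 Mw).
  by rewrite a0 mul0r sub0r subr0 cabsN ltxx.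
exists (b / a).
  case=> [z//|] /=; rewrite RE.
  by rewrite -(projZ 1 (b / a) a0) mulr1 mulrC divfK.
move=> s; have : clim (nbhs_strip_infty s)
    (fun x => (a * (ev g x.2 / ev f x.2) - b) * a^-1 + b / a) (0 * a^-1 + b / a).
  by apply: climD; [apply: climM; [exact: lim0|exact: clim_cst]|exact: clim_cst].
rewrite mul0r add0r; apply: clim_ext => x.
by rewrite mulrBl subrK mulrAC divff// mul1r.
Qed.

(** The Cayley transforms (1 + i k)/(1 - i k) of the naturals are infinitely many points of the
    circle. *)
Lemma unit_circle_nonroot (p : {poly C}) : p != 0 -> exists2 u : C, cabs u = 1 & ~~ root p u.
Proof.
move=> p0; pose c (k : nat) : C := (1 +i* k%:R) / (1 +i* - k%:R).
have den0 (k : nat) : 1 +i* (- k%:R : R) != 0.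
  by rewrite eq_complex /= oner_eq0.
have c1 k : cabs (c k) = 1.
  rewrite cabsM cabsV -(cabsJ (1 +i* - k%:R)) /= opprK divff// cabs_eq0.
  by rewrite eq_complex /= oner_eq0.
have c_inj : injective c.
  move=> k l /eqP; rewrite eqr_div//.
  rewrite eq_complex /= => /andP[_ /eqP h].
  have /eqP : (k%:R : R) = l%:R by move: h; lra.
  by rewrite eqr_nat => /eqP.
have [/allP all_root|/allPn[u /mapP[k _ ->] nroot]] :=
    boolP (all (root p) [seq c k | k <- iota 0 (size p)]); last by exists (c k).
have uniq_c : uniq [seq c k | k <- iota 0 (size p)] by rewrite map_inj_uniq ?iota_uniq.
have := max_poly_roots p0 (introT allP all_root) uniq_c.
by rewrite size_map size_iota ltnn.
Qed.

(** On the ray through a unit root the polynomial vanishes, so the limit would be 0; on the ray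
    through a unit point that is no root it grows like t^d. *)
Lemma has_limit_no_unit_root (d : nat) (p : zpoly R) : (0 < d)%N ->
  (forall m, m \in msupp p -> mdeg m = d) -> p != 0 -> has_limit_at_infty p ->
  forall u : C, cabs u = 1 -> ~~ root (tilde d p) u.
Proof.
move=> d0 pd p0 [L lim] u u1; apply/negP => /eqP pu.
have ev_ray (v : C) (t : R) : cabs v = 1 -> 0 < t ->
    ev p (t%:C * v) = t%:C ^+ d * ((v^*) ^+ d * (tilde d p).[v]).
  move=> v1 t0; have v0 : v != 0 by rewrite -cabs_gt0 v1.
  have tC0 : t%:C != 0 by rewrite fmorph_eq0 lt0r_neq0.
  rewrite (ev_tilde pd); last by rewrite mulf_neq0.
  rewrite cabsM cabs_real v1 mulr1 gtr0_norm// mulrAC divff// mul1r.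
  have -> : ((t%:C * v)^*)%R = t%:C * (v^*)%R.
    by rewrite rmorphM; congr (_ * _); exact: conjc_real.
  by rewrite exprMn mulrA.
have L0 : L = Some 0.
  have small e : 0 < e -> chord (Some (0 : C)) L < e.
    move=> e0; have [M h] := lim e e0.
    have t0 : 0 < `|M| + 1 by rewrite ltr_wpDl.
    have := h ((`|M| + 1)%:C * u); rewrite ev_ray// pu !mulr0; apply.
    by rewrite cabsM u1 mulr1 cabs_real gtr0_norm//; have := ler_norm M; lra.
  case: L small {lim} => [l|] small.
    congr Some; apply/eqP/contraT => l0.
    have l1 : 0 < cabs l by rewrite cabs_gt0.
    have c0 : 0 < chord (Some (0 : C)) (Some l).
      rewrite /= sub0r cabsN divr_gt0 ?mulr_gt0// sqrtr_gt0.
      by rewrite mulr_gt0// ltr_pwDl// sqr_ge0.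
    by have := small _ c0; rewrite ltxx.
  by exfalso; have := small _ ltr01; rewrite /= cabs0 expr0n addr0 sqrtr1; lra.
have [v v1 vroot] := unit_circle_nonroot (tilde_neq0 pd p0).
have [M h] := lim 1 ltr01; rewrite L0 in h.
pose tau := cabs (tilde d p).[v].
have tau0 : 0 < tau by rewrite cabs_gt0.
(* Far enough for the limit to apply, and large enough for t^d tau >= 1; a value of modulus at least
   1 is at chordal distance at least 1 from 0. *)
pose t := Num.max 1 (Num.max (`|M| + 1) tau^-1).
have t1 : 1 <= t by rewrite le_max lexx.
have t2 : M < t.
  by apply: (@lt_le_trans _ _ (`|M| + 1)); [have := ler_norm M; lra|rewrite !le_max lexx orbT].
have t3 : tau^-1 <= t by rewrite !le_max lexx !orbT.
have t0 : 0 < t by lra.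
have := h (t%:C * v); rewrite cabsM v1 mulr1 cabs_real gtr0_norm// => /(_ t2).
rewrite ev_ray//; set y := _ * _.
have y1 : 1 <= cabs y.
  rewrite /y !cabsM !cabsX cabsJ v1 expr1n mul1r cabs_real gtr0_norm// -/tau.
  apply: (@le_trans _ _ (t * tau)); first by rewrite -ler_pdivrMr// mul1r.
  by rewrite ler_pM2r// -[leLHS]expr1 ler_weXn2l.
rewrite /= subr0 cabs0 expr0n addr0 mulr1.
have y2 : 1 <= cabs y ^+ 2 by rewrite exprn_ege1.
rewrite ltr_pdivrMr; last by rewrite sqrtr_gt0; lra.
rewrite mul1r ltNge => /negP; apply.
rewrite -[leRHS]ger0_norm; last by rewrite mulr_ge0// cabs_ge0.
by rewrite -sqrtr_sqr ler_wsqrtr// exprMn; lra.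
Qed.

Lemma growth (m K k : R) (d : nat) : 0 < m -> 0 <= k -> (0 < d)%N ->
  forall B, exists2 M, 1 <= M &
    forall r, M < r -> B < m * r ^+ d - K * r ^+ d.-1 - k.
Proof.
move=> m0 k0 d0 B.
exists (Num.max 1 ((`|B| + K + k) / m)); first by rewrite le_max lexx.
move=> r; rewrite gt_max ltr_pdivrMr// => /andP[r1 rB].
rewrite -{1}(prednK d0) exprS.
set q := r ^+ _; have q1 : 1 <= q by rewrite exprn_ege1// ltW.
have h : `|B| + k < m * r - K by lra.
have h2 : q * (`|B| + k) < q * (m * r - K) by rewrite ltr_pM2l//; lra.
have h3 : 1 * (`|B| + k) <= q * (`|B| + k) by rewrite ler_wpM2r// addr_ge0.
have h4 : m * (r * q) - K * q = q * (m * r - K) by ring.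
by have := ler_norm B; lra.
Qed.

End Degree.

(** * Assembly of the homotopies and proof of the theorem *)

Section Main.
Variable R : realType.
Local Notation C := R[i].

Lemma ev_homog_factor d (p : zpoly R) (lc : C) (rs : seq C) : (0 < d)%N ->
  (forall m, m \in msupp p -> mdeg m = d) ->
  tilde d p = lc *: \prod_(r <- rs) ('X - r%:P) ->
  forall z, ev p z = (z^*) ^+ d * (lc * \prod_(r <- rs) (dir z - r)).
Proof.
move=> d0 pd pE z; have [z0|z0] := eqVneq z 0.
  rewrite z0 rmorph0 (expr0n _ d) gtn_eqF// mul0r evE big_seq big1// => m /pd.
  rewrite mdeg2 rmorph0 !expr0n => md.
  case: (m ord0) md => [|?] md; last by rewrite mul0r mulr0.
  case: (m (lift ord0 ord0)) md => [|?] md; last by rewrite !mulr0.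
  by rewrite -md in d0.
rewrite (ev_tilde pd z0) pE hornerZ horner_prod; congr (_ * (_ * _)).
by apply: eq_bigr => r _; rewrite hornerXsubC.
Qed.

(** On the unit circle each factor |u - r| is at least the distance of |r| to 1. *)
Lemma homog_lower_bound d (p : zpoly R) (lc : C) (rs : seq C) : (0 < d)%N ->
  (forall m, m \in msupp p -> mdeg m = d) ->
  tilde d p = lc *: \prod_(r <- rs) ('X - r%:P) -> lc != 0 ->
  all (fun r => cabs r != 1) rs ->
  exists2 m : R, 0 < m & forall z, m * cabs z ^+ d <= cabs (ev p z).
Proof.
move=> d0 pd pE lc0 rs1; exists (cabs lc * \prod_(r <- rs) `|1 - cabs r|).
  rewrite mulr_gt0 ?cabs_gt0// big_seq prodr_gt0// => r /(allP rs1) r1.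
  by rewrite normr_gt0 subr_eq0 eq_sym.
move=> z; have [->|z0] := eqVneq z 0.
  by rewrite cabs0 expr0n gtn_eqF// mulr0 cabs_ge0.
rewrite (ev_homog_factor d0 pd pE) mulrC cabsM cabsX cabsJ.
rewrite ler_wpM2l ?exprn_ge0 ?cabs_ge0// cabsM ler_wpM2l ?cabs_ge0// cabs_prod.
apply: ler_prod => r _; rewrite normr_ge0 /=.
have := lerB_cabsD (dir z) (- r); have := lerB_cabsD r (- dir z).
by rewrite !cabsN (cabsB r) cabs_dir// => h1 h2; rewrite ler_norml; lra.
Qed.

Lemma ev_leading d (p : zpoly R) : tdeg p = d -> (0 < d)%N ->
  exists2 K : R, 0 <= K & forall z, 1 <= cabs z ->
    cabs (ev p z - ev (homog_part d p) z) <= K * cabs z ^+ d.-1.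
Proof.
move=> pd d0; have [|K K0 hK] := @ev_bound R (p - homog_part d p) d.-1.
  by move=> m; rewrite -{1}pd => /msupp_sub_homog_part; rewrite pd; case: d d0 {pd}.
by exists K => // z z1; rewrite -evB hK.
Qed.

(** The remainder f - T - a is O(|z|^(d-1)), so scaling it down to 0 never competes with T. *)
Lemma leading_homotopy d (f : zpoly R) (m : R) (k a : C) : tdeg f = d -> (0 < d)%N ->
  0 < m -> (forall z, m * cabs z ^+ d <= cabs (ev (homog_part d f) z)) ->
  k != 0 ->
  homotopic (affine_ext (fun z => k * (ev f z - a)))
            (affine_ext (fun z => k * ev (homog_part d f) z)).
Proof.
move=> fd d0 m0 hm k0; have [K K0 hK] := ev_leading fd d0.
move: (homog_part d f) hm hK => T hm hK.
apply: homotopic_ext (@affine_homotopy _ (fun s z =>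
  k * (ev T z + (1 - s%:C) * (ev f z - ev T z - a))) _ _).
- by case=> [z|//] /=; rewrite rmorph0 subr0 mul1r; congr (Some (_ * _)); ring.
- by case=> [z|//] /=; rewrite rmorph1 subrr mul0r addr0.
- move=> s z s01; have tc := @clim_strip_time R s z.
  have ec p : clim (nbhs_strip s z) (fun x => ev p x.2) (ev p z).
    by apply: clim_ev; apply: clim_strip_point.
  apply: climM; first exact: clim_cst.
  apply: climD => //; apply: climM; first by apply: climB => //; apply: clim_cst.
  by apply: climB; [apply: climB|exact: clim_cst].
- move=> B; have [M M1 hM] := growth K m0 (cabs_ge0 a) d0 (B / cabs k).
  exists M => s z s01 Mz.
  have := hM _ Mz; rewrite ltr_pdivrMr ?cabs_gt0// => /lt_le_trans; apply.
  rewrite cabsM mulrC ler_wpM2l ?cabs_ge0//.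
  have h1 := lerB_cabsD (ev T z) ((1 - s%:C) * (ev f z - ev T z - a)).
  have h2 := ler_cabsB (ev f z - ev T z) a.
  have h3 : cabs ((1 - s%:C) * (ev f z - ev T z - a)) <= cabs (ev f z - ev T z - a).
    have -> : 1 - s%:C = (1 - s)%:C by rewrite rmorphB rmorph1.
    rewrite cabsM cabs_real ger0_norm; last lra.
    by rewrite -[leRHS]mul1r ler_wpM2r ?cabs_ge0//; lra.
  have h4 : cabs (ev f z - ev T z) <= K * cabs z ^+ d.-1 by apply: hK; lra.
  apply: le_trans h1; rewrite -addrA -opprD; apply: lerB (hm z) _.
  by apply: (le_trans h3); apply: (le_trans h2); rewrite lerD2r.
Qed.

Lemma degree_positive d (f g : zpoly R) (Rinf : sphere R) (lc : C) (rs : seq C) :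
  (forall z : C, ~ (ev f z = 0 /\ ev g z = 0)) -> (msize g <= msize f)%N ->
  tdeg f = d -> (0 < d)%N ->
  tilde d (homog_part d f) = lc *: \prod_(r <- rs) ('X - r%:P) ->
  lc != 0 -> all (fun r => cabs r != 1) rs ->
  sphere_continuous (ratmap f g Rinf) ->
  has_degree (ratmap f g Rinf)
    ((count (fun r : C => cabs r < 1) rs)%:Z - d%:Z).
Proof.
move=> fg0 sgf fd d0 TE lc0 rs1 cont.
have Td m : m \in msupp (homog_part d f) -> mdeg m = d by apply: msupp_homog_part.
have [m m0 hm] := homog_lower_bound d0 Td TE lc0 rs1.
have [K K0 hK] := ev_leading fd d0.
have step3 := leading_homotopy _ fd d0 m0 hm.
move: (homog_part d f) TE Td hm hK step3 => T TE Td hm hK step3.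
have f_ge z : 1 <= cabs z -> m * cabs z ^+ d - K * cabs z ^+ d.-1 <= cabs (ev f z).
  move=> z1; have := lerB_cabsD (ev T z) (ev f z - ev T z); rewrite subrKC.
  by apply: le_trans; apply: lerB (hm z) (hK z z1).
have finf : tends_to_infty (fun _ => ev f).
  move=> B; have [M M1 hM] := growth K m0 (lexx 0) d0 B.
  exists M => _ z _ Mz; have := hM _ Mz; rewrite subr0 => /lt_le_trans; apply.
  by apply: f_ge; lra.
have gd m' : m' \in msupp g -> (mdeg m' <= d)%N.
  by move=> /msize_mdeg_lt; move: sgf; rewrite -fd /tdeg; lia.
have [Kg Kg0 hKg] := ev_bound gd.
have [q0 RE wq] : exists2 q0 : C, ratmap f g Rinf =1 proj_ext (ev f) (ev g) q0 &
    forall s, clim (nbhs_strip_infty s) (fun x => ev g x.2 / ev f x.2) q0.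
  (* Beyond 2 K / m the lower-order terms of [f] cost at most half of m |z|^d. *)
  apply: (@ratmap_infty _ _ _ _ (Num.max 1 (2 * K / m)) (Kg / (m / 2))) => // z.
  rewrite gt_max ltr_pdivrMr// => /andP[z1 zK].
  have z0 : 0 < cabs z by lra.
  have f2 : m / 2 * cabs z ^+ d <= cabs (ev f z).
    apply: le_trans (f_ge z (ltW z1)); rewrite -(prednK d0) exprS /=.
    set q := cabs z ^+ _; have q0 : 0 < q by rewrite exprn_gt0.
    have : K * q <= cabs z * m / 2 * q by rewrite ler_pM2r//; lra.
    by lra.
  have zd0 : 0 < cabs z ^+ d by rewrite exprn_gt0.
  have f0 : 0 < cabs (ev f z) by apply: lt_le_trans f2; rewrite mulr_gt0// divr_gt0.
  split; first by rewrite -cabs_gt0.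
  rewrite cabsM cabsV ler_pdivrMr//.
  apply: (le_trans (hKg _ _ (ltW z1) (lexx _))).
  have -> : Kg * cabs z ^+ d = Kg / (m / 2) * (m / 2 * cabs z ^+ d).
    by field; exact: lt0r_neq0.
  by rewrite ler_wpM2l// divr_ge0// ltW// divr_gt0.
have [M0 hM0] := finf 1; pose r := Num.max 1 M0.
have r1 : 1 <= r by rewrite le_max lexx.
have f_gt1 z : r < cabs z -> 1 < cabs (ev f z).
  by rewrite gt_max => /andP[_]; apply: (hM0 0); rewrite lexx ler01.
pose Bg := Kg * r ^+ d.
have Bg0 : 0 <= Bg by rewrite mulr_ge0// exprn_ge0//; lra.
(* [Mc] exceeds |g| on the disk of radius [r]; the tolerance 1/(2 Mc) then makes |Mc eps| at most
   1/2, below |f| outside that disk. *)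
pose Mc := Bg + 1; have Mc1 : 1 <= Mc by rewrite /Mc; lra.
have Mc0 : 0 < Mc by lra.
have eta0 : 0 < 1 / (2 * Mc) by rewrite divr_gt0// mulr_gt0.
have r0 : 0 < r by lra.
have [eps [c [eps_le c_ge avoid]]] := generic_direction r0 eta0 fg0.
have c0 : c != 0 by rewrite -cabs_gt0; lra.
have eps_small : Mc * cabs eps < 1.
  have : Mc * cabs eps <= Mc * (1 / (2 * Mc)) by rewrite ler_pM2l.
  have -> : Mc * (1 / (2 * Mc)) = 1 / 2 by field; exact: lt0r_neq0.
  lra.
have McC0 : Mc%:C != 0 by rewrite fmorph_eq0 lt0r_neq0.
have step1 := @pencil_homotopy _ f g q0 0 (Mc%:C * eps) 1 0 0 (Mc%:C * c) finf wq.
have step2 := @pencil_homotopy _ f g q0 (Mc%:C * eps) 0 1 (-1) (Mc%:C * c) 0 finf wq.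
have {}step1 : homotopic (ratmap f g Rinf)
    (proj_ext (fun z => ev f z - Mc%:C * eps) (fun z => ev g z - Mc%:C * c) q0).
  apply: homotopic_ext (step1 _).
  - by move=> x; rewrite RE; case: x => [z|] /=; rewrite rmorph0 !(mul0r, addr0, mul1r, subr0).
  - by case=> [z|] /=; rewrite rmorph1 !(mulr0, mul1r, add0r, addr0).
  (* A common zero means (f, g) = s Mc (eps, c): impossible outside the disk since |f| > 1,
     impossible inside by the choice of direction, or for s = 0 by hypothesis. *)
  - move=> s z s01; apply/orP; rewrite -negb_and; apply/negP => /andP[].
    rewrite !add0r mulr0 addr0 mul1r !subr_eq0 => /eqP fz /eqP gz.
    have sMc : s%:C * Mc%:C = (s * Mc)%:C by rewrite rmorphM.
    rewrite !mulrA sMc in fz gz.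
    have [zr|rz] := leP (cabs z) r; last first.
      have := f_gt1 z rz; rewrite fz cabsM cabs_real ger0_norm; last first.
        by rewrite mulr_ge0//; lra.
      have : s * Mc * cabs eps <= 1 * (Mc * cabs eps).
        by rewrite -mulrA ler_wpM2r// ?mulr_ge0 ?cabs_ge0//; lra.
      by lra.
    have [s0|s0] := eqVneq s 0.
      by apply: (fg0 z); rewrite fz gz s0 mul0r rmorph0 !mul0r.
    apply: (avoid z (s * Mc) zr) => //.
    by rewrite mulr_gt0// lt_def s0; case/andP: s01.
have {}step2 : homotopic
    (proj_ext (fun z => ev f z - Mc%:C * eps) (fun z => ev g z - Mc%:C * c) q0)
    (affine_ext (fun z => - (Mc%:C * c)^-1 * (ev f z - Mc%:C * eps))).
  apply: homotopic_ext (step2 _).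
  - by case=> [z|] /=; rewrite rmorph0 !(mul0r, addr0, mul1r).
  - case=> [z|] /=; rewrite rmorph1 !(mulr0, mul1r, subrr, mul0r, addr0) ?proj0// sub0r.
    have k0 : - (Mc%:C * c)^-1 != 0 by rewrite oppr_eq0 invr_neq0// mulf_neq0.
    rewrite -(projZ _ _ k0) mulrNN mulVf ?proj1// mulf_neq0//.
  (* f = Mc eps forces the point into the disk, where |(1-s) g| <= Bg < Mc <= |Mc c|. *)
  - move=> s z s01; apply/orP; rewrite -negb_and; apply/negP => /andP[].
    rewrite !mulr0 !addr0 !subr_eq0 => /eqP fz /eqP gz.
    have zr : cabs z <= r.
      rewrite leNgt; apply/negP => /f_gt1; rewrite fz cabsM cabs_real gtr0_norm//; lra.
    have := congr1 (@cabs R) gz; rewrite !cabsM !cabs_real gtr0_norm//.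
    have -> : 1 + s%:C * -1 = (1 - s)%:C by rewrite mulrN1 rmorphB rmorph1.
    rewrite cabs_real ger0_norm; last lra.
    have : (1 - s) * cabs (ev g z) <= 1 * Bg.
      by apply: ler_pM; rewrite ?cabs_ge0//; [lra|lra|exact: hKg].
    have : Mc * 1 <= Mc * cabs c by rewrite ler_pM2l.
    by rewrite /Mc; lra.
set k := - (Mc%:C * c)^-1 in step2.
have k0 : k != 0 by rewrite oppr_eq0 invr_neq0// mulf_neq0.
have step4 := root_homotopy (mulf_neq0 k0 lc0) d0 rs1.
have [k' k'0 k'E] := prod_inner_outer rs.
have kk0 : k * lc * k' != 0 by rewrite !mulf_neq0// k'0.
set N := count _ rs in k'E *.
have step5 := constant_homotopy N kk0 d0.
have step6 := @std_homotopy R d N d0.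
apply: homotopic_trans step1 _; apply: homotopic_trans step2 _.
apply: homotopic_trans (step3 _ _ k0) _.
apply: homotopic_trans (homotopic_trans step5 step6).
apply: homotopic_ext step4; case=> [z|//] /=; congr Some.
  by rewrite (ev_homog_factor d0 Td TE); ring.
by rewrite k'E; ring.
Qed.

Lemma degree_zero (f g : zpoly R) (Rinf : sphere R) :
  f != 0 -> (msize g <= msize f)%N -> tdeg f = 0%N -> sphere_continuous (ratmap f g Rinf) ->
  has_degree (ratmap f g Rinf) 0.
Proof.
move=> f_neq0 sgf d0 cont.
have sf : (msize f <= 1)%N by move: d0; rewrite /tdeg; lia.
have fE z : ev f z = f@_0%MM by rewrite {1}(msize1_polyC sf) /ev mevalC.
have gE z : ev g z = g@_0%MM by rewrite {1}(msize1_polyC (leq_trans sgf sf)) /ev mevalC.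
have f0 z : ev f z != 0.
  by rewrite fE; apply: contraNneq f_neq0 => f0; rewrite (msize1_polyC sf) f0 mpolyC0.
have [|q0 RE wq] := @ratmap_infty R f g Rinf 0 (cabs (g@_0%MM / f@_0%MM)) _ cont.
  by move=> z _; rewrite fE gE -(fE 0) f0.
apply: homotopic_ext (nonvanishing_homotopy f0 wq); first by move=> x; rewrite RE.
by case=> [z|] //=; rewrite expr0.
Qed.

Lemma ltr_norm_cabs (r : C) : (`|r| < 1) = (cabs r < 1).
Proof. by rewrite cabsE -(rmorph1 (real_complex R)) ltcR. Qed.

End Main.

Theorem theorem2 (R : realType) (f g : zpoly R) :
  (forall z : R[i], ~ (ev f z = 0 /\ ev g z = 0)) ->
  (msize g <= msize f)%N ->
  let d := tdeg f in
  let T := homog_part d f in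
  has_limit_at_infty T ->
  forall Rinf : sphere R, sphere_continuous (ratmap f g Rinf) ->
  forall N : nat, nroots_in_disk (tilde d T) N ->
    has_degree (ratmap f g Rinf) (N%:Z - d%:Z) /\
    winding_number (fun a : R => ev2 T (expi a) (expi (- a))) 0 (2 * pi)
      (N%:Z - d%:Z).
Proof.
move=> fg0 sgf d T lim Rinf cont N [rs pE NE].
have f0 : f != 0.
  apply/eqP => f0; have g0 : g = 0.
    by apply/eqP; move: sgf; rewrite f0 msize0 leqn0 msize_poly_eq0.
  by apply: (fg0 0); rewrite f0 g0 /ev !meval0.
have Td m : m \in msupp T -> mdeg m = d by apply: msupp_homog_part.
have T0 : T != 0 by apply: homog_part_tdeg_neq0.
have tilde0 := tilde_neq0 Td T0.
have lc0 : lead_coef (tilde d T) != 0 by rewrite lead_coef_eq0.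
have {}NE : N = count (fun r => cabs r < 1) rs.
  by rewrite NE; apply: eq_count => r; rewrite ltr_norm_cabs.
(* In degree 0 the limit says nothing about the circle, but [tilde] is then a nonzero constant and
   has no roots. *)
have d0_rs : d = 0%N -> rs = [::].
  move=> d0; apply/eqP; rewrite -size_eq0 -leqn0 -ltnS -(size_prod_XsubC rs id).
  by rewrite -(size_scale _ lc0) -pE d0; apply: size_tilde0 => m /Td ->.
have rs1 : all (fun r => cabs r != 1) rs.
  have [/d0_rs ->//|d_gt0] := posnP d.
  apply/allP => r rrs; apply/eqP => r1.
  have /negP := has_limit_no_unit_root d_gt0 Td T0 lim r1; apply.
  by rewrite pE rootZ// root_prod_XsubC.
split.
  have [d0|d_gt0] := posnP d.
    by rewrite NE (d0_rs d0) d0; apply: degree_zero.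
  by rewrite NE; apply: degree_positive pE _ _ _.
apply: total_arg_winding.
(* The three terms come from e^(-it d), the leading coefficient and the linear factors. *)
have -> : N%:Z - d%:Z = - d%:Z + (0 + N%:Z) by rewrite add0r addrC.
rewrite NE.
apply: total_arg_ext (total_argM (total_arg_expiNX R d)
  (total_argM (total_arg_cst lc0) (total_arg_prod rs1))) => t.
rewrite (ev2_tilde Td (expiNl t)) [in RHS]pE hornerZ horner_prod; congr (_ * (_ * _)).
by apply: eq_bigr => r _; rewrite hornerXsubC.
Qed.
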